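(* Let $n\in\mathbb N$ be fixed. Then, for any $m\in\{1,\dots,2n\}$, there exists a $4n$-dimensional nilpotent complex symplectic Lie algebra $(\mathfrak g,J,\omega)$ of step length $m$. Moreover, if $m\ge2$ and $(n,m)\ne(1,2)$, then there exists such a $(\mathfrak g,J,\omega)$ ($4n$-dimensional, nilpotent of step length $m$) with $\mathfrak g$ indecomposable and $J$ non-Abelian nilpotent, and there also exists such a $(\mathfrak g,J,\omega)$ with $\mathfrak g$ indecomposable and $J$ Abelian.
   Context: A complex symplectic Lie algebra $(\mathfrak g,J,\omega)$ is a real Lie algebra with $J\in\operatorname{End}(\mathfrak g)$, $J^2=-\mathrm{Id}$, vanishing Nijenhuis tensor $N_J(X,Y)=[X,Y]+J[JX,Y]+J[X,JY]-[JX,JY]$, and a closed non-degenerate $2$-form $\omega$ with $\omega(JX,Y)=\omega(X,JY)$. $J$ is Abelian if $[X,Y]=[JX,JY]$ for all $X,Y$. A complex structure $J$ on $\mathfrak g$ is nilpotent if the series $\mathfrak a_0(J)=\{0\}$, $\mathfrak a_k(J)=\{X\in\mathfrak g\mid[X,\mathfrak g]\subseteq\mathfrak a_{k-1}(J),\ [JX,\mathfrak g]\subseteq\mathfrak a_{k-1}(J)\}$ satisfies $\mathfrak a_k(J)=\mathfrak g$ for some $k$. Step length is the nilpotency step (non-zero Abelian Lie algebras have step length $1$). A Lie algebra is indecomposable if it is not a direct sum of two non-zero Lie algebras. *)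

(* Defs.v *)
From HB Require Import structures.
From mathcomp Require Import all_boot all_order all_algebra.
From mathcomp Require Export sesquilinear.
From mathcomp Require Export reals.

Set Implicit Arguments.
Unset Strict Implicit.
Unset Printing Implicit Defensive.

Import GRing.Theory.
Local Open Scope ring_scope.

Reserved Notation "[ 'lie' x , y ]" (format "[ 'lie'  x ,  y ]").

HB.mixin Record isLieAlgebra (F : fieldType) (V : Type) of Vector F V := {
  lie_bracket : V -> V -> V;
  lie_bilinear : bilinear_for *:%R *:%R lie_bracket;
  liexx : forall x, lie_bracket x x = 0;
  lie_jacobi : forall x y z,
    lie_bracket x (lie_bracket y z) + lie_bracket y (lie_bracket z x)
      + lie_bracket z (lie_bracket x y) = 0
}.

(* All Lie algebras are finite-dimensional. *)
#[short(type="lieAlgType")]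
HB.structure Definition LieAlgebra (F : fieldType) :=
  { V of isLieAlgebra F V & Vector F V }.

Notation "[ 'lie' x , y ]" := (lie_bracket x y) : ring_scope.

HB.instance Definition _ (F : fieldType) (g : lieAlgType F) :=
  bilinear_isBilinear.Build F g g g *:%R *:%R (@lie_bracket F g) lie_bilinear.

Section DirectSum.
Variables (F : fieldType) (g1 g2 : lieAlgType F).

Definition prod_lie (x y : g1 * g2) : g1 * g2 :=
  ([lie x.1, y.1], [lie x.2, y.2]).

Fact prod_lie_bilinear : bilinear_for *:%R *:%R prod_lie.
Proof.
by split=> u a x y; rewrite /prod_lie /= ?linearPl ?linearPr.
Qed.

Fact prod_liexx x : prod_lie x x = 0.
Proof. by rewrite /prod_lie !liexx. Qed.

Fact prod_lie_jacobi x y z :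
  prod_lie x (prod_lie y z) + prod_lie y (prod_lie z x)
    + prod_lie z (prod_lie x y) = 0.
Proof. by congr (_, _); apply: lie_jacobi. Qed.

HB.instance Definition _ := isLieAlgebra.Build F (g1 * g2)%type
  prod_lie_bilinear prod_liexx prod_lie_jacobi.

End DirectSum.

Definition lie_isomorphic (F : fieldType) (g h : lieAlgType F) : Prop :=
  exists2 f : 'Hom(g, h), bijective f &
    forall x y, f [lie x, y] = [lie f x, f y].

Definition indecomposable (F : fieldType) (g : lieAlgType F) : Prop :=
  forall g1 g2 : lieAlgType F,
    (0 < \dim {:g1})%N -> (0 < \dim {:g2})%N ->
    ~ lie_isomorphic g (g1 * g2)%type.

Section LowerCentralSeries.
Variables (F : fieldType) (g : lieAlgType F).
Implicit Types U V W : {vspace g}.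

(* The span of all brackets [lie u, v] with u in U and v in V: see lieprodP. *)
Definition lieprod U V : {vspace g} :=
  <<allpairs (fun u v => [lie u, v]) (vbasis U) (vbasis V)>>%VS.

Lemma memv_lie U V : {in U & V, forall u v, [lie u, v] \in lieprod U V}.
Proof.
move=> u v /coord_vbasis-> /coord_vbasis->.
rewrite linear_sumlz; apply: memv_suml => i _.
rewrite linear_sumr; apply: memv_suml => j _.
rewrite linearZlr !memvZ // memv_span //.
by apply/allpairsP; exists ((vbasis U)`_i, (vbasis V)`_j); rewrite !mem_nth ?size_tuple.
Qed.

Lemma lieprodP U V W :
  reflect {in U & V, forall u v, [lie u, v] \in W} (lieprod U V <= W)%VS.
Proof.
apply: (iffP idP) => [sUVW u v Uu Vv | sUVW].
  by rewrite (subvP sUVW) ?memv_lie.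
apply/span_subvP=> _ /allpairsP[[u v] /= [Uu Vv ->]].
by rewrite sUVW ?vbasis_mem.
Qed.

Fixpoint lcs (k : nat) : {vspace g} :=
  if k is k'.+1 then lieprod fullv (lcs k') else fullv.

(* lcs is indexed from 0, so a non-zero Abelian algebra has step 1. *)
Definition nilpotent_of_step (m : nat) : Prop :=
  lcs m = 0%VS /\ forall k, (k < m)%N -> lcs k <> 0%VS.

End LowerCentralSeries.

Arguments nilpotent_of_step {F} g m.

Section ComplexSymplectic.
Variables (F : fieldType) (g : lieAlgType F).
Implicit Types (J : 'End(g)) (omega : {skew_symmetric g}).

Definition nijenhuis J (x y : g) : g :=
  [lie x, y] + J [lie J x, y] + J [lie x, J y] - [lie J x, J y].

Definition complex_structure J : Prop :=
  (forall x, J (J x) = - x) /\ (forall x y, nijenhuis J x y = 0).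

Definition abelian_cs J : Prop := forall x y, [lie x, y] = [lie J x, J y].

(* Membership in the term a_k(J) of the ascending series. *)
Fixpoint ascending_cs J (k : nat) (x : g) : Prop :=
  if k is k'.+1 then
    forall y, ascending_cs J k' [lie x, y] /\ ascending_cs J k' [lie J x, y]
  else x = 0.

Definition nilpotent_cs J : Prop :=
  exists k, forall x, ascending_cs J k x.

(* The Chevalley-Eilenberg differential of a 2-form. *)
Definition d2form (omega : g -> g -> F) (x y z : g) : F :=
  - omega [lie x, y] z + omega [lie x, z] y - omega [lie y, z] x.

Definition closed_form omega : Prop := forall x y z, d2form omega x y z = 0.

Definition complex_symplectic J omega : Prop :=
  [/\ complex_structure J,
      closed_form omega,
      nondegenerate omega
    & forall x y, omega (J x) y = omega x (J y)].

End ComplexSymplectic.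

(* Main.v *)
Require Import Defs.
From HB Require Import structures.
From mathcomp Require Import all_boot all_order all_algebra.
From mathcomp Require Import sesquilinear reals ring zify lra.
From mathcomp Require Import complex.

Set Implicit Arguments.
Unset Strict Implicit.
Unset Printing Implicit Defensive.

Import GRing.Theory.
Local Open Scope ring_scope.

(** The Lie algebras are built on V = C^n + C^n, with complex coordinates
    q_0, ..., q_(n-1) (positions) and p_0, ..., p_(n-1) (momenta) and the
    standard complex symplectic form, from a real-linear map x |-> A(x) of V
    into sp(V), by

      [x, y] = A(x) y - A(y) x,      J = multiplication by i.

    Read A as a connection: it is torsion-free by definition of the bracket,
    it preserves J because each A(x) is complex-linear, and it preserves the
    symplectic form because A(x) lies in sp(V). Hence J is integrable and the
    real part of the symplectic form is closed, whatever A is, and only the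
    Jacobi identity constrains A. It holds as soon as the A(x) commute and
    A(A(x) y) z is symmetric in x and z. If moreover A(ix) = -i A(x), then
    [ix, iy] = [x, y], so that J is Abelian.

    All the examples have the form A(x) = a(x) N + b(x) P with commuting
    nilpotent N, P in sp(V), where P has rank one, and real-linear functions
    a, b with values in C. Let s(u + iv) = u + i eps v.

    - Step m >= 3: the chain algebras. Take a = s(coordinate of x on q_0), so
      that N is applied by q_0 and i q_0 alone, and let N run through
      q_1 -> ... -> q_k -> p_k -> ... -> p_1 up to signs, with q_j -> p_j for
      j > k. For m = 2k + 2 extend N by q_0 -> q_1 and
      p_1 -> p_0 and take b = 0: the bracket [q_0, i q_0] is a nonzero
      multiple of i q_1 when eps <> 1, and from there ad(q_0) needs 2k + 1
      steps to reach 0. For odd m > n no element of sp(V) is nilpotent of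
      order exactly m, since its Jordan blocks of odd size come in pairs. For
      m = 2k + 1 the missing arrow p_1 -> p_0 is therefore supplied by the
      other half of the bracket: b = s(coordinate of x on p_1) and P sends
      q_0 to p_0, so that [q_0, p_1] = -p_0, while q_1 is no longer a bracket.
      Here the Jacobi identity requires eps^2 = 1. The value eps = -1 makes J
      Abelian; eps = 0 (m even) and eps = 1 (m odd) give a J which is not.

    - Step 2: in a chain with k = 0 the vector p_0 is central, but on the
      complex line of p_0 the derived algebra contains only the real multiples
      of i p_0, and the criterion below does not apply. For n >= 2 another
      choice makes the derived algebra the whole complex span of the p_j: N
      sends q_0 to p_1, q_1 to p_0 and q_j to p_j for j >= 2, while P sends q_1
      to p_1 and b = i conj(coordinate of x on q_1). Then both real directions
      of the line of p_1 are reached, by [q_0, i q_0] and by [q_1, i q_1].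

    The steps are computed with a filtration by coordinate subspaces, which
    bounds the lower central series from above and also shows that J is
    nilpotent, and with an iterated bracket, which bounds it from below.
    Indecomposability comes from a criterion on centralizers: if
    g = g1 + g2, then the centralizer of k = k1 + k2 is the sum of those of k1
    and k2, so that an element with a small Abelian centralizer leaves no room
    for two non-Abelian summands, and an Abelian summand is excluded as soon as
    the centre lies in the derived algebra. *)

(** * Steps, nilpotent complex structures and indecomposability *)

Section LieGeneral.
Variables (F : fieldType) (g : lieAlgType F).
Implicit Types x y z : g.

Lemma lieC x y : [lie x, y] = - [lie y, x].
Proof.
have := liexx (x + y); rewrite linearDr /= !linearDl /= !liexx add0r addr0.
by rewrite addrC => /eqP; rewrite addr_eq0 => /eqP.
Qed.

Lemma lie0r x : [lie x, 0] = 0.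
Proof. exact: linear0r. Qed.

Lemma lie0l x : [lie 0, x] = 0.
Proof. by rewrite lieC lie0r oppr0. Qed.

(** Predicates rather than subspaces, so that a condition on coordinates can be
    used without naming the subspace it defines. *)
Record lie_filtration (P : nat -> g -> Prop) : Prop := LieFiltration {
  filt_all : forall x, P 0 x;
  filt_zero : forall k, P k 0;
  filt_lin : forall k a x y, P k x -> P k y -> P k (a *: x + y);
  filt_lie : forall k x y, P k y -> P k.+1 [lie x, y]
}.

Section Filtration.
Variables (P : nat -> g -> Prop) (fP : lie_filtration P).

Lemma lcs_filtration k x : x \in lcs g k -> P k x.
Proof.
elim: k x => [|k IHk] x; first by move=> _; apply: filt_all fP _.
rewrite /= /lieprod; set X := allpairs _ _ _ => xX.
rewrite (coord_span (X := in_tuple X) xX).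
elim/big_rec: _ => [|i y _ Py]; first exact: filt_zero fP k.+1.
apply: (filt_lin fP) => //.
have: (in_tuple X)`_i \in X by rewrite mem_nth.
case/allpairsP => -[u v] /= [_ vV ->].
by apply: (filt_lie fP); apply: IHk; apply: vbasis_mem.
Qed.

(** The subspaces P (m - k) climb to g as k grows, and the k-th of them lies in
    the k-th term of the ascending series: bracketing with x or J x gains one
    level of the filtration. *)
Lemma filtration_nilpotent_cs (J : 'End(g)) m :
  (forall k x, P k x -> P k (J x)) -> (forall x, P m x -> x = 0) ->
  nilpotent_cs J.
Proof.
move=> PJ Pm; exists m => x.
suff asc k : (k <= m)%N -> forall y, P (m - k) y -> ascending_cs J k y.
  by apply: (asc m) => //; rewrite subnn; exact: (filt_all fP).
elim: k => [|k IHk] lekm {x} x; first by rewrite subn0 => /Pm.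
move=> Px /= y.
have E : (m - k = (m - k.+1).+1)%N by rewrite subnSK.
have PN l z : P l z -> P l (- z).
  by move=> Pz; rewrite -scaleN1r -[_ *: _]addr0; apply: (filt_lin fP) (filt_zero fP _).
split; apply: (IHk (ltnW lekm)); rewrite E lieC; apply: PN; apply: (filt_lie fP) => //.
exact: PJ.
Qed.

(** The filtration bounds the lower central series from above and the iterated
    bracket from below; this suffices, since the series stays 0 once it
    reaches 0. *)
Lemma filtration_step m x y :
  (0 < m)%N -> (forall z, P m z -> z = 0) ->
  iter m.-1 (lie_bracket y) x <> 0 -> nilpotent_of_step g m.
Proof.
move=> m_gt0 Pm xm; split=> [|k lt_km lcsk].
  by apply/eqP; rewrite -subv0; apply/subvP=> z /lcs_filtration/Pm->; rewrite mem0v.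
suff: iter m.-1 (lie_bracket y) x \in lcs g m.-1.
  have -> : lcs g m.-1 = 0%VS; last by rewrite memv0 => /eqP.
  have -> : (m.-1 = m.-1 - k + k)%N by rewrite subnK // -ltnS prednK.
  elim: (m.-1 - k)%N => [//|j IHj]; rewrite addSn /= IHj.
  apply/eqP; rewrite -subv0; apply/lieprodP => u v _.
  by rewrite !memv0 => /eqP->; rewrite lie0r.
elim: m.-1 => [|j IHj]; first exact: memvf.
by rewrite iterS memv_lie ?memvf.
Qed.

End Filtration.

End LieGeneral.

Section Indecomposable.
Variables (F : fieldType) (g : lieAlgType F).

(** In g = g1 + g2 write k = k1 + k2. The centralizer C(k) is the sum of
    C(k1) in g1 and C(k2) in g2, and both k1 and k2 lie in it. If neither is
    central, then C(k1), which contains g2, and C(k2), which contains g1, both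
    lie in the hyperplane h = 0, and this is absurd because they span g. If,
    say, k1 is central, then g1 lies in C(k), so g1 is Abelian and therefore
    central; the last hypothesis puts it into [g, g] = [g2, g2], and g1 = 0. *)
Lemma indecomposableI (k : g) (h : {scalar g}) (z : g) :
    (forall x y, [lie k, x] = 0 -> [lie k, y] = 0 -> [lie x, y] = 0) ->
    (forall a, [lie k, a] = 0 ->
      (forall y, [lie a, y] = 0) \/ (forall y, [lie a, y] = 0 -> h y = 0)) ->
    h z <> 0 ->
    (forall x, (forall y, [lie x, y] = 0) -> x \in lcs g 1) ->
  indecomposable g.
Proof.
move=> kC kH hz Zlcs.
(* no summand is Abelian: it would be central, but the second component of a
   bracket is a bracket of second components *)
have noab (g1 g2 : lieAlgType F) (f : g -> g1 * g2) (f' : g1 * g2 -> g) :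
    linear f -> cancel f f' -> cancel f' f ->
    (forall x y, f [lie x, y] = [lie f x, f y]) ->
    (0 < \dim {:g2})%N -> (forall u v : g2, [lie u, v] = 0) -> False.
  move=> fL fK f'K fl dim2 ab2.
  have f0 : f 0 = 0 by have := fL (-1) 0 0; rewrite !scaler0 !addr0 scaleN1r addNr.
  have [u u0] : exists u : g2, u != 0.
    exists (vpick {:g2}); rewrite vpick0; apply: contraTneq dim2 => ->.
    by rewrite dimv0.
  pose P (j : nat) (x : g) := if j is 0%N then True else (f x).2 = 0.
  have inD : f' (0, u) \in lcs g 1.
    apply: Zlcs => y; apply: (can_inj fK); rewrite fl f'K f0.
    by congr (_, _) => /=; rewrite ?lie0l ?ab2.
  have: P 1%N (f' (0, u)).
    apply: lcs_filtration inD; split=> //.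
    - by case=> [|j] //; rewrite /P f0.
    - by move=> [|j] a x y //=; rewrite fL /= => -> ->; rewrite scaler0 addr0.
    - by move=> [|j] x y _; rewrite /P fl /= ab2.
  by rewrite /P f'K; apply/eqP.
move=> g1 g2 d1 d2 [f [f' fK f'K] fl].
have fL : linear f by move=> *; exact: linearP.
have f'L : {morph f' : x y / x + y}.
  by move=> x y; apply: (can_inj fK); rewrite linearD /= !f'K.
pose C x y := [lie f' x, f' y] = 0.
have CE x y : C x y <-> [lie x.1, y.1] = 0 /\ [lie x.2, y.2] = 0.
  rewrite /C; split=> [e|[e1 e2]].
    have := congr1 f e; rewrite fl !f'K linear0 => e'.
    by split; [have := congr1 fst e' | have := congr1 snd e'].
  by apply: (can_inj fK); rewrite fl !f'K linear0; congr (_, _).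
pose K := f k; have kE : k = f' K by rewrite fK.
have Ksplit x : [lie k, f' x] = 0 <-> C (K.1, 0) x /\ C (0, K.2) x.
  rewrite kE -/(C K x) !CE /= !lie0l; tauto.
have Cl x : C (K.1, 0) (0, x) by apply/CE; rewrite /= lie0r lie0l.
have Cr x : C (0, K.2) (x, 0) by apply/CE; rewrite /= lie0r lie0l.
have K1 : [lie k, f' (K.1, 0)] = 0 by apply/Ksplit; rewrite !CE /= !liexx !lie0r !lie0l.
have K2 : [lie k, f' (0, K.2)] = 0 by apply/Ksplit; rewrite !CE /= !liexx !lie0r !lie0l.
case: (kH _ K1) => [c1|h1].
  pose sw (x : g) := ((f x).2, (f x).1).
  apply: (noab g2 g1 sw (fun x => f' (x.2, x.1))) => //.
  - by move=> a x y; rewrite /sw fL.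
  - by move=> x; rewrite /sw /= -surjective_pairing fK.
  - by move=> [x y]; rewrite /sw /= f'K.
  - by move=> x y; rewrite /sw fl.
  move=> u v; have: C (u, 0) (v, 0).
    by apply: kC; apply/Ksplit; split; rewrite // /C c1.
  by case/CE.
case: (kH _ K2) => [c2|h2].
  apply: (noab g1 g2 f f') => // u v; have: C (0, u) (0, v).
    by apply: kC; apply/Ksplit; split; rewrite // /C c2.
  by case/CE.
apply: hz; rewrite -[z]fK.
have -> : f z = ((f z).1, 0) + (0, (f z).2).
  by rewrite /GRing.add /= /add_pair /= addr0 add0r -surjective_pairing.
by rewrite f'L linearD /= (h2 _ (Cr _)) (h1 _ (Cl _)) addr0.
Qed.
End Indecomposable.

(** * Lie algebras from products with commuting left multiplications *)

(** Under these two identities the Jacobi identity of the commutator becomes a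
    cancellation in pairs. The second one exchanges the outer factors x and z,
    not y and z as right commutativity would. *)
Record commuting_product (F : fieldType) (V : vectType F) := CommutingProduct {
  cmul : V -> V -> V;
  cmul_bilinear : bilinear_for *:%R *:%R cmul;
  cmulCA : forall x y z, cmul x (cmul y z) = cmul y (cmul x z);
  cmulAC : forall x y z, cmul (cmul x y) z = cmul (cmul z y) x
}.

HB.instance Definition _ F V (A : @commuting_product F V) :=
  bilinear_isBilinear.Build F V V V *:%R *:%R (cmul A) (cmul_bilinear A).

Definition commutator_algebra (F : fieldType) (V : vectType F)
  of commuting_product V : Type := V.

Section CommutatorAlgebra.
Variables (F : fieldType) (V : vectType F) (A : commuting_product V).

Local Notation commutator_algebra := (commutator_algebra A).
HB.instance Definition _ := Vector.on commutator_algebra.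

Definition commutator (x y : V) : V := cmul A x y - cmul A y x.

Fact commutator_bilinear : bilinear_for *:%R *:%R commutator.
Proof.
by split=> u a x y; rewrite /commutator /= linearPl linearPr /= scalerBr opprD addrACA.
Qed.

Fact commutatorxx x : commutator x x = 0.
Proof. exact: subrr. Qed.

(** Expanding gives twelve products. The six of the form x (y z) cancel in pairs
    by [cmulCA], the six of the form (x y) z cancel in pairs by [cmulAC]. *)
Fact commutator_jacobi x y z :
  commutator x (commutator y z) + commutator y (commutator z x)
    + commutator z (commutator x y) = 0.
Proof.
rewrite /commutator !linearBr !linearBl /=.
rewrite (cmulCA A x y z) (cmulCA A z x y) (cmulCA A y z x).
rewrite (cmulAC A y z x) (cmulAC A z y x) (cmulAC A z x y).
have cycle3 (p q r : V) : (p - q) + (r - p) + (q - r) = 0.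
  by rewrite addrAC subrKA addrC subrKA subrr.
have cycle3' (p q r : V) : (p - q) + (q - r) + (r - p) = 0.
  by rewrite subrKA subrKA subrr.
have split6 (a b c d e f : V) :
    (a + b) + (c + d) + (e + f) = (a + c + e) + (b + d + f).
  by rewrite [a + b + _]addrACA [_ + (e + f)]addrACA.
by rewrite ![- (_ - _)]opprB split6 cycle3 cycle3' addr0.
Qed.

HB.instance Definition _ := isLieAlgebra.Build F commutator_algebra
  commutator_bilinear commutatorxx commutator_jacobi.

Lemma lie_commutator (x y : commutator_algebra) :
  [lie x, y] = cmul A x y - cmul A y x :> V.
Proof. by []. Qed.

(** A torsion-free connection that preserves J makes J integrable. *)
Lemma commutator_complex_structure (J : 'End(commutator_algebra)) :
  (forall x, J (J x) = - x) ->
  (forall x y, cmul A x (J y) = J (cmul A x y)) -> complex_structure J.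
Proof.
move=> JJ Jr; split=> // x y; rewrite /nijenhuis !lie_commutator.
rewrite !Jr ![J (_ - _)]linearB /= !JJ opprK [_ - _ + (_ + _)]addrACA addNr addr0.
by rewrite [_ + _ + (_ - _)]addrACA subrr add0r subrr.
Qed.

(** The hypothesis says that left multiplications are infinitesimally
    symplectic: a torsion-free connection that preserves omega makes omega
    closed. *)
Lemma commutator_closed (omega : {skew_symmetric commutator_algebra}) :
  (forall x y z, omega (cmul A x y) z = omega (cmul A x z) y) ->
  closed_form omega.
Proof.
move=> sym x y z; rewrite /d2form !lie_commutator ![omega (_ - _) _]linearBl /=.
rewrite (sym x y z) (sym y x z) (sym z x y); ring.
Qed.
End CommutatorAlgebra.

(** * The complex vector space C^n + C^n over the reals *)

Local Open Scope complex_scope.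

Section Phase.
Variables (R : rcfType) (n : nat).
Local Notation C := R[i].

Definition phase : Type := 'rV[C]_n * 'rV[C]_n.
HB.instance Definition _ := GRing.Lmodule.on phase.

(** A second name for the same space: [phase] keeps its complex scalars, while
    [real_phase] carries the real ones. *)
Definition real_phase : Type := phase.
HB.instance Definition _ := GRing.Zmodule.on real_phase.

Definition real_scale (a : R) (x : real_phase) : real_phase :=
  a%:C *: (x : phase).

Fact real_scaleA a b x : real_scale a (real_scale b x) = real_scale (a * b) x.
Proof. by rewrite /real_scale scalerA -rmorphM. Qed.
Fact real_scale1 : left_id 1 real_scale.
Proof. by move=> x; rewrite /real_scale rmorph1 scale1r. Qed.
Fact real_scaleDr : right_distributive real_scale +%R.
Proof. by move=> a x y; rewrite /real_scale scalerDr. Qed.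
Fact real_scaleDl x : {morph real_scale^~ x : a b / a + b}.
Proof. by move=> a b; rewrite /real_scale rmorphD scalerDl. Qed.

HB.instance Definition _ := GRing.Zmodule_isLmodule.Build R real_phase
  real_scaleA real_scale1 real_scaleDr real_scaleDl.

Definition real_coords (x : real_phase) : 'rV[R]_((n + n) + (n + n)) :=
  row_mx (row_mx (map_mx (@Re R) x.1) (map_mx (@Im R) x.1))
         (row_mx (map_mx (@Re R) x.2) (map_mx (@Im R) x.2)).

Lemma ReD (u v : C) : Re (u + v) = Re u + Re v.
Proof. by case: u v => [? ?] []. Qed.
Lemma ImD (u v : C) : Im (u + v) = Im u + Im v.
Proof. by case: u v => [? ?] []. Qed.
Lemma ReZ (a : R) (c : C) : Re (a%:C * c) = a * Re c.
Proof. by case: c => u v /=; rewrite mul0r subr0. Qed.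
Lemma ImZ (a : R) (c : C) : Im (a%:C * c) = a * Im c.
Proof. by case: c => u v /=; rewrite mul0r addr0. Qed.

Fact real_phase_iso : SemiVector.axiom ((n + n) + (n + n)) real_phase.
Proof.
pose inv (v : 'rV[R]_((n + n) + (n + n))) : real_phase :=
  let l := lsubmx v in let r := rsubmx v in
  (\row_i (lsubmx l 0 i +i* rsubmx l 0 i), \row_i (lsubmx r 0 i +i* rsubmx r 0 i)).
exists real_coords.
  split=> [a|] x; [|move=> y]; rewrite /real_coords.
    rewrite !scale_row_mx; congr row_mx; congr row_mx;
    by apply/rowP=> i; rewrite !mxE ?ReZ ?ImZ.
  rewrite !add_row_mx; congr row_mx; congr row_mx;
  by apply/rowP=> i; rewrite !mxE ?ReD ?ImD.
exists inv => [[x y]|v].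
  rewrite /inv /real_coords /= !(row_mxKl, row_mxKr).
  by congr (_, _); apply/rowP=> i; rewrite !mxE; case: (_ 0 i).
rewrite -[RHS]hsubmxK -[lsubmx v in RHS]hsubmxK -[rsubmx v in RHS]hsubmxK.
by congr row_mx; congr row_mx; apply/rowP=> i; rewrite !mxE.
Qed.

HB.instance Definition _ := LSemiModule_hasFinDim.Build R real_phase
  real_phase_iso.
HB.instance Definition _ := SemiVector.on real_phase.

Lemma dim_real_phase : dim real_phase = (4 * n)%N.
Proof. by rewrite -[LHS]/(n + n + (n + n))%N !addnn -mul2n -mul2n mulnA. Qed.

End Phase.

(** * The symplectic form and its infinitesimal symmetries *)

(** In block form, with vectors as rows, the elements of sp(V) that map momenta
    to momenta are exactly these, for E symmetric; [spP] is the case S = 0,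
    E = e_ii. *)
HB.lock Definition spN (R : rcfType) n (S E : 'M[R[i]]_n) (u : phase R n) :
  phase R n := (u.1 *m S, u.1 *m E - u.2 *m S^T).
HB.lock Definition spP (R : rcfType) n (i : 'I_n) (u : phase R n) : phase R n :=
  (0, u.1 0 i *: delta_mx 0 i).

Section SymplecticForm.
Variables (R : rcfType) (n : nat).
Local Notation C := R[i].
Local Notation phase := (phase R n).
Local Notation real_phase := (real_phase R n).
Implicit Types (x y z u : phase) (c : C).

Lemma phaseZ c x : c *: x = (c *: x.1, c *: x.2). Proof. by []. Qed.
Lemma phaseD x y : x + y = (x.1 + y.1, x.2 + y.2). Proof. by []. Qed.

Definition dot (a b : 'rV[C]_n) : C := (a *m b^T) 0 0.

Lemma dotC a b : dot a b = dot b a.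
Proof. by rewrite /dot -[a in LHS]trmxK -trmx_mul mxE. Qed.
Lemma dotDl a a' b : dot (a + a') b = dot a b + dot a' b.
Proof. by rewrite /dot mulmxDl mxE. Qed.
Lemma dotZl c a b : dot (c *: a) b = c * dot a b.
Proof. by rewrite /dot -scalemxAl mxE. Qed.
Lemma dotBl a a' b : dot (a - a') b = dot a b - dot a' b.
Proof. by rewrite -scaleN1r dotDl dotZl mulN1r. Qed.
Lemma dot0l b : dot 0 b = 0.
Proof. by rewrite /dot mul0mx mxE. Qed.
Lemma dot_mull a (M : 'M_n) b : dot (a *m M) b = dot a (b *m M^T).
Proof. by rewrite /dot trmx_mul trmxK mulmxA. Qed.
Lemma dot_delta i a : dot (delta_mx 0 i) a = a 0 i.
Proof. by rewrite /dot -rowE !mxE. Qed.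

Definition spform x y : C := dot x.1 y.2 - dot x.2 y.1.

Lemma spformC x y : spform x y = - spform y x.
Proof. by rewrite /spform dotC [dot x.2 _]dotC opprB. Qed.

Lemma spformZl c x y : spform (c *: x) y = c * spform x y.
Proof. by rewrite /spform phaseZ /= !dotZl mulrBr. Qed.

Lemma spformDl x y z : spform (x + y) z = spform x z + spform y z.
Proof. by rewrite /spform phaseD /= !dotDl opprD addrACA. Qed.

Lemma spformZr c x y : spform x (c *: y) = c * spform x y.
Proof. by rewrite [LHS]spformC spformZl -mulrN -spformC. Qed.

Lemma spformDr x y z : spform x (y + z) = spform x y + spform x z.
Proof. by rewrite [LHS]spformC spformDl opprD -!(spformC x). Qed.

Lemma ReN (u : C) : Re (- u) = - Re u.
Proof. by case: u. Qed.

Definition re_spform (x y : real_phase) : R := Re (spform x y).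

Fact re_spform_bilinear :
  bilinear_for ( *%R : R -> R -> R) (idfun \; *%R : R -> R -> R) re_spform.
Proof.
split=> u a x y; rewrite /re_spform.
  by rewrite -[spform _ u]/(spform ((a%:C *: (x : phase)) + y) u)
     spformDl spformZl ReD ReZ.
by rewrite -[spform u _]/(spform u ((a%:C *: (x : phase)) + y))
     spformDr spformZr ReD ReZ.
Qed.

Fact re_spform_skew x y :
  re_spform x y = (-1) ^+ true * idfun (re_spform y x).
Proof. by rewrite expr1 mulN1r /re_spform spformC ReN. Qed.

HB.instance Definition _ := bilinear_isBilinear.Build R real_phase real_phase R
  ( *%R) (idfun \; *%R) re_spform re_spform_bilinear.
HB.instance Definition _ := isHermitianSesquilinear.Build R real_phase true idfun
  re_spform re_spform_skew.

Definition phase_omega : {skew_symmetric real_phase} := re_spform.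

(** A complex number whose product with every complex number has real part 0
    vanishes, so the real part of the form has the same radical as the form. *)
Lemma phase_omega_nondegenerate : nondegenerate phase_omega.
Proof.
rewrite /nondegenerate -subv0; apply/subvP=> x /mem_orthovP x0; rewrite memv0.
have sp0 y : spform x y = 0.
  have r0 := x0 _ (memvf (y : real_phase)).
  have i0 := x0 _ (memvf ('i%C *: y : real_phase)).
  move: r0 i0; rewrite -[phase_omega _ _]/(Re (spform x y)).
  rewrite -[phase_omega _ _]/(Re (spform x ('i%C *: y))) spformZr.
  case: (spform x y) => a b /= ->; rewrite mulr0 mul1r sub0r => /eqP.
  by rewrite oppr_eq0 => /eqP->.
apply/eqP; case: x sp0 {x0} => x1 x2 sp0; congr (_, _); apply/rowP=> i.
  have := sp0 (0, delta_mx 0 i).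
  by rewrite /spform /= [X in _ - X]dotC dot0l subr0 dotC dot_delta mxE.
have := sp0 (delta_mx 0 i, 0).
rewrite /spform /= dotC dot0l sub0r dotC dot_delta mxE => /eqP.
by rewrite oppr_eq0 => /eqP.
Qed.

Variables (S E : 'M[C]_n) (i : 'I_n).

Local Notation spN := (@spN R n S E).
Local Notation spP := (@spP R n i).

Fact spN_linear : linear spN.
Proof.
move=> a x y; rewrite spN.unlock; congr (_, _) => /=; rewrite !mulmxDl -!scalemxAl //.
by rewrite opprD addrACA scalerBr.
Qed.
HB.instance Definition _ := GRing.isLinear.Build C phase phase _ spN spN_linear.

Fact spP_linear : linear spP.
Proof.
move=> a x y; rewrite spP.unlock; congr (_, _) => /=; first by rewrite scaler0 addr0.
by rewrite !mxE scalerDl scalerA.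
Qed.
HB.instance Definition _ := GRing.isLinear.Build C phase phase _ spP spP_linear.

Lemma spform_spN x y : E^T = E -> spform (spN x) y = spform (spN y) x.
Proof.
move=> symE.
rewrite /spform spN.unlock !dotBl (dot_mull x.1 S) (dotC x.1) (dot_mull y.1 S).
by rewrite (dotC y.1) (dot_mull x.1 E) symE (dotC x.1) !opprB addrCA.
Qed.

Lemma spform_spP x y : spform (spP x) y = spform (spP y) x.
Proof.
by rewrite /spform spP.unlock /= !dot0l !dotZl !dot_delta mulrC.
Qed.

End SymplecticForm.

(** * Complex symplectic Lie algebras from pairs of shears *)

Section TwistedProduct.
Variables (K : comNzRingType) (V : lmodType K).
Variables (N P : {linear V -> V}) (cN cP : V -> K).
Implicit Types x y z : V.

Definition twist x y := cN x *: N y + cP x *: P y.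

Lemma twistPl a x y z :
    cN (a *: x + y) = a * cN x + cN y -> cP (a *: x + y) = a * cP x + cP y ->
  twist (a *: x + y) z = a *: twist x z + twist y z.
Proof. by rewrite /twist => -> ->; rewrite !scalerDl scalerDr !scalerA addrACA. Qed.

Lemma twistZr a x y : twist x (a *: y) = a *: twist x y.
Proof. by rewrite /twist !linearZ /= scalerDr !scalerA ![a * _]mulrC. Qed.

Lemma twistDr x y z : twist x (y + z) = twist x y + twist x z.
Proof. by rewrite /twist !(linearD N) !(linearD P) !scalerDr addrACA. Qed.

Hypothesis PN0 : forall x, P (N x) = 0.
Hypothesis NP0 : forall x, N (P x) = 0.

Lemma twistCA x y z : twist x (twist y z) = twist y (twist x z).
Proof.
rewrite /twist !linearD !linearZ /= !PN0 !NP0 !scaler0 !addr0 !add0r !scalerA.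
by rewrite [cN x * _]mulrC [cP x * _]mulrC.
Qed.

Hypotheses (cND : {morph cN : x y / x + y}) (cPD : {morph cP : x y / x + y}).
Hypotheses (cN_N : forall x, cN (N x) = 0) (cN_P : forall x, cN (P x) = 0).
Hypothesis cP_P : forall x, cP (P x) = 0.
Hypothesis cP_N : forall x y z,
  cP (N (cN x *: y)) *: P z = cP (N (cN z *: y)) *: P x.

(** All the terms in which cN meets a value of N or P, or cP a value of P,
    vanish; what is left is the hypothesis [cP_N]. *)
Lemma twistAC x y z : twist (twist x y) z = twist (twist z y) x.
Proof.
have cN0 u v : cN (twist u v) = 0.
  by rewrite /twist -!linearZ /= cND cN_N cN_P addr0.
have cPE u v : cP (twist u v) = cP (N (cN u *: v)).
  by rewrite /twist -!linearZ /= cPD cP_P addr0.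
by rewrite [LHS]/twist [RHS]/twist !cN0 !cPE !scale0r !add0r cP_N.
Qed.

Lemma twist_antilinear i x y : i * i = -1 ->
    (forall u, cN (i *: u) = - i * cN u) -> (forall u, cP (i *: u) = - i * cP u) ->
  twist (i *: x) (i *: y) = twist x y.
Proof.
move=> mulii hN hP; rewrite twistZr /twist hN hP scalerDr !scalerA !mulrA mulrN mulii.
by rewrite opprK !mul1r.
Qed.
End TwistedProduct.

Definition real_linear (R : rcfType) n (c : phase R n -> R[i]) :=
  forall (a : R) (x y : phase R n), c (a%:C *: x + y) = a%:C * c x + c y.

(** A pair of elements N, P of sp(V) with real-linear coefficients, such that
    x |-> shN x N + shP x P satisfies the two identities of a
    [commuting_product]. Only [shP_N] relates the coefficients to each other:
    in the examples either shP vanishes on the image of N, or the coefficients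
    are both linear or both antilinear and P reads off the same coordinate as
    shN. *)
Record shear (R : rcfType) (n : nat) := Shear {
  shS : 'M[R[i]]_n;
  shE : 'M[R[i]]_n;
  shI : 'I_n;
  shN : phase R n -> R[i];
  shP : phase R n -> R[i];
  shE_sym : shE^T = shE;
  shN_lin : real_linear shN;
  shP_lin : real_linear shP;
  shPN : forall u, spP shI (spN shS shE u) = 0;
  shNP : forall u, spN shS shE (spP shI u) = 0;
  shN_N : forall u, shN (spN shS shE u) = 0;
  shN_P : forall u, shN (spP shI u) = 0;
  shP_P : forall u, shP (spP shI u) = 0;
  shP_N : forall x y z,
    shP (spN shS shE (shN x *: y)) *: spP shI z =
    shP (spN shS shE (shN z *: y)) *: spP shI x
}.

Section ShearAlgebra.
Variables (R : rcfType) (n : nat) (D : shear R n).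
Local Notation C := R[i].
Local Notation phase := (phase R n).
Local Notation real_phase := (real_phase R n).
Local Notation N := (spN (shS D) (shE D)).
Local Notation P := (spP (shI D)).
Implicit Types x y z : phase.

Definition shear_mul : phase -> phase -> phase := twist N P (shN D) (shP D).

Fact shear_mul_bilinear :
  bilinear_for *:%R *:%R (shear_mul : real_phase -> real_phase -> real_phase).
Proof.
split=> u a x y; first exact: twistPl (shN_lin D a x y) (shP_lin D a x y).
by rewrite [LHS]twistDr [X in X + _]twistZr.
Qed.

Lemma shN_add x y : shN D (x + y) = shN D x + shN D y.
Proof. by have := shN_lin D 1 x y; rewrite rmorph1 mul1r scale1r. Qed.
Lemma shP_add x y : shP D (x + y) = shP D x + shP D y.
Proof. by have := shP_lin D 1 x y; rewrite rmorph1 mul1r scale1r. Qed.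

Fact shear_mulCA x y z :
  shear_mul x (shear_mul y z) = shear_mul y (shear_mul x z).
Proof. exact: twistCA (shPN D) (shNP D) x y z. Qed.

Fact shear_mulAC x y z :
  shear_mul (shear_mul x y) z = shear_mul (shear_mul z y) x.
Proof.
exact: twistAC shN_add shP_add (shN_N D) (shN_P D) (shP_P D) (shP_N D) x y z.
Qed.

Lemma spform_shear_mul x y z :
  spform (shear_mul x y) z = spform (shear_mul x z) y.
Proof.
have spE u v : spform (shear_mul x u) v =
    shN D x * spform (N u) v + shP D x * spform (P u) v.
  by rewrite -(spformZl _ (N u)) -(spformZl _ (P u)) -spformDl.
apply: etrans (spE y z) _; apply: etrans _ (esym (spE z y)).
exact: (congr2 (fun u v => shN D x * u + shP D x * v)
  (spform_spN _ y z (shE_sym D)) (spform_spP _ y z)).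
Qed.

Definition shear_product : commuting_product real_phase :=
  CommutingProduct shear_mul_bilinear shear_mulCA shear_mulAC.

Definition shear_algebra : lieAlgType R := commutator_algebra shear_product.

Lemma dim_shear_algebra : \dim {:shear_algebra} = (4 * n)%N.
Proof. by rewrite dimvf -(dim_real_phase R n). Qed.

Definition imul (x : real_phase) : real_phase := 'i%C *: (x : phase).
Fact imul_linear : linear imul.
Proof.
move=> a x y; rewrite /imul -[_ *: x + y]/(a%:C *: (x : phase) + y).
by rewrite scalerDr scalerA mulrC -scalerA.
Qed.
HB.instance Definition _ := GRing.isLinear.Build R real_phase real_phase _ imul
  imul_linear.

Definition shear_J : 'End(shear_algebra) := linfun imul.

Lemma shear_JE (x : shear_algebra) : shear_J x = 'i%C *: (x : phase).
Proof. by rewrite lfunE. Qed.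

Lemma mulii : 'i%C * 'i%C = -1 :> C.
Proof. by rewrite -expr2 sqr_i. Qed.

Lemma shear_complex_symplectic :
  complex_symplectic shear_J (phase_omega R n : {skew_symmetric shear_algebra}).
Proof.
split.
- apply: commutator_complex_structure => [x|x y]; last first.
    rewrite !shear_JE; exact: (twistZr N P (shN D) (shP D) 'i%C x y).
  by rewrite !shear_JE scalerA mulii scaleN1r.
- by apply: commutator_closed => x y z; congr Re; exact: spform_shear_mul.
- exact: phase_omega_nondegenerate.
- move=> x y; rewrite !shear_JE; congr Re.
  by rewrite spformZl spformZr.
Qed.

(** Antilinear coefficients: A(ix)(iy) = -i A(x)(iy) = A(x) y. *)
Lemma shear_abelian :
  (forall x, shN D ('i%C *: x) = - 'i%C * shN D x) ->
  (forall x, shP D ('i%C *: x) = - 'i%C * shP D x) -> abelian_cs shear_J.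
Proof.
move=> hN hP x y; rewrite !shear_JE.
exact: (congr2 (fun u v : phase => u - v)
  (esym (twist_antilinear N P x y mulii hN hP))
  (esym (twist_antilinear N P y x mulii hN hP))).
Qed.

End ShearAlgebra.

(** * Brackets in coordinates *)

(** Coordinates are indexed by natural numbers, so that the neighbours j - 1 and
    j + 1 of an index can be written without a proof that they are in range. An
    index j > n reads the coordinate of index 0. *)
HB.lock Definition pos (R : rcfType) n (x : phase R n.+1) (j : nat) : R[i] :=
  x.1 0 (inord j).
HB.lock Definition mom (R : rcfType) n (x : phase R n.+1) (j : nat) : R[i] :=
  x.2 0 (inord j).

Section Coordinates.
Variables (R : rcfType) (n : nat).
Local Notation C := R[i].
Local Notation phase := (phase R n.+1).
Implicit Types (x y z u : phase) (c : C) (j : nat).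

Definition of_coords (f g : nat -> C) : phase := (\row_j f j, \row_j g j).

Lemma pos_of f g j : (j <= n)%N -> pos (of_coords f g) j = f j.
Proof. by move=> jn; rewrite !pos.unlock mxE inordK. Qed.
Lemma mom_of f g j : (j <= n)%N -> mom (of_coords f g) j = g j.
Proof. by move=> jn; rewrite !mom.unlock mxE inordK. Qed.

Lemma phaseP x y :
  (forall j, (j <= n)%N -> pos x j = pos y j /\ mom x j = mom y j) -> x = y.
Proof.
case: x y => [a b] [a' b'] h.
by congr (_, _); apply/rowP=> i; have [] := h i (leq_ord i);
  rewrite !(pos.unlock, mom.unlock) inord_val.
Qed.

Definition pos_unit a : phase := of_coords (fun j => (j == a)%:R) (fun=> 0).
Definition mom_unit a : phase := of_coords (fun=> 0) (fun j => (j == a)%:R).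

Lemma pos_pos_unit a j : (j <= n)%N -> pos (pos_unit a) j = (j == a)%:R.
Proof. exact: pos_of. Qed.
Lemma mom_mom_unit a j : (j <= n)%N -> mom (mom_unit a) j = (j == a)%:R.
Proof. exact: mom_of. Qed.
Lemma mom_pos_unit a j : mom (pos_unit a) j = 0.
Proof. by rewrite mom.unlock mxE. Qed.
Lemma pos_mom_unit a j : pos (mom_unit a) j = 0.
Proof. by rewrite pos.unlock mxE. Qed.

Lemma pos0 j : pos (0 : phase) j = 0. Proof. by rewrite !pos.unlock mxE. Qed.
Lemma mom0 j : mom (0 : phase) j = 0. Proof. by rewrite !mom.unlock mxE. Qed.
Lemma posD x y j : pos (x + y) j = pos x j + pos y j.
Proof. by rewrite !pos.unlock mxE. Qed.
Lemma momD x y j : mom (x + y) j = mom x j + mom y j.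
Proof. by rewrite !mom.unlock mxE. Qed.
Lemma posZ c x j : pos (c *: x) j = c * pos x j.
Proof. by rewrite !pos.unlock mxE. Qed.
Lemma momZ c x j : mom (c *: x) j = c * mom x j.
Proof. by rewrite !mom.unlock mxE. Qed.
Lemma posB x y j : pos (x - y) j = pos x j - pos y j.
Proof. by rewrite !pos.unlock !mxE. Qed.
Lemma momB x y j : mom (x - y) j = mom x j - mom y j.
Proof. by rewrite !mom.unlock !mxE. Qed.

Lemma pos_spP i x j : pos (spP i x) j = 0.
Proof. by rewrite spP.unlock !pos.unlock mxE. Qed.
Lemma mom_spP i x j : (i <= n)%N -> (j <= n)%N ->
  mom (spP (inord i) x) j = (j == i)%:R * pos x i.
Proof.
move=> iN jN; rewrite spP.unlock !(pos.unlock, mom.unlock) /= !mxE /= mulrC.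
by rewrite -val_eqE /= !inordK.
Qed.

(** P has rank one, so multiples of its values are compared through a single
    coordinate. *)
Lemma eq_scale_spP i a b x y : (i <= n)%N ->
  a * pos x i = b * pos y i -> a *: spP (inord i) x = b *: spP (inord i) y.
Proof.
move=> iN; rewrite spP.unlock pos.unlock => e.
by rewrite !phaseZ /= !scalerA e !scaler0.
Qed.

Lemma mom_spNZ (S E : 'M[C]_n.+1) c x j :
  mom (spN S E (c *: x)) j = c * mom (spN S E x) j.
Proof. by rewrite linearZ momZ. Qed.

Lemma pos_spNZ (S E : 'M[C]_n.+1) c x j :
  pos (spN S E (c *: x)) j = c * pos (spN S E x) j.
Proof. by rewrite linearZ posZ. Qed.

(** The matrices below have at most one nonzero entry in each row and column,
    equal to 1. The flag b tells whether it is there, and m is its position. *)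
Definition sparse (v : 'I_n.+1 -> C) (m : nat) (b : bool) :=
  (b -> (m <= n)%N) /\ (forall l : 'I_n.+1, v l = ((l == m :> nat) && b)%:R).

Lemma sum_sparse (f g : 'I_n.+1 -> C) (m : nat) (b : bool) :
  sparse g m b -> \sum_l f l * g l = if b then f (inord m) else 0.
Proof.
case=> bn gE; under eq_bigr do rewrite gE; case: b bn {gE} => bn; last first.
  by rewrite big1 // => l _; rewrite andbF mulr0.
have mn : (m < n.+1)%N by rewrite ltnS bn.
rewrite (bigD1 (inord m)) //= inordK // eqxx mulr1 big1 ?addr0 // => l.
by rewrite -val_eqE /= inordK // => /negPf->; rewrite mulr0.
Qed.

Lemma pos_spN (S E : 'M[C]_n.+1) x j m b :
  sparse (fun l => S l (inord j)) m b ->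
  pos (spN S E x) j = if b then pos x m else 0.
Proof. by rewrite spN.unlock !pos.unlock mxE => /sum_sparse->. Qed.

Lemma mom_spN (S E : 'M[C]_n.+1) x j m b m' b' :
    sparse (fun l => E l (inord j)) m b -> sparse (S (inord j)) m' b' ->
  mom (spN S E x) j =
    (if b then pos x m else 0) - (if b' then mom x m' else 0).
Proof.
rewrite spN.unlock !(pos.unlock, mom.unlock) !mxE => /sum_sparse-> sb.
by congr (_ - _); under eq_bigr do rewrite mxE; rewrite (sum_sparse _ sb).
Qed.

Lemma pos_twist a b c d u v w x j :
  pos ((a *: u + b *: v) - (c *: w + d *: x)) j =
  (a * pos u j + b * pos v j) - (c * pos w j + d * pos x j).
Proof. by rewrite posB !posD !posZ. Qed.
Lemma mom_twist a b c d u v w x j :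
  mom ((a *: u + b *: v) - (c *: w + d *: x)) j =
  (a * mom u j + b * mom v j) - (c * mom w j + d * mom x j).
Proof. by rewrite momB !momD !momZ. Qed.

Section Bracket.
Variable D : shear R n.+1.
Local Notation N := (spN (shS D) (shE D)).
Local Notation P := (spP (shI D)).

Lemma pos_lie (x y : shear_algebra D) j :
  pos [lie x, y] j = shN D x * pos (N y) j - shN D y * pos (N x) j.
Proof.
rewrite [LHS](pos_twist _ _ _ _ (N y) (P y) (N x) (P x)) !pos_spP.
by rewrite !mulr0 !addr0.
Qed.

Lemma mom_lie (x y : shear_algebra D) j : mom [lie x, y] j =
  (shN D x * mom (N y) j + shP D x * mom (P y) j) -
  (shN D y * mom (N x) j + shP D y * mom (P x) j).
Proof. exact: (mom_twist _ _ _ _ (N y) (P y) (N x) (P x)). Qed.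
End Bracket.

End Coordinates.

Arguments of_coords [R].
Arguments pos_unit : clear implicits.
Arguments mom_unit : clear implicits.

Section Sigma.
Variables (R : rcfType).
Local Notation C := R[i].
(** Conjugation, real part and identity at once, for eps = -1, 0 and 1. *)
Definition sig (eps : R) (c : C) : C := Re c +i* (eps * Im c).

Lemma sig_linear eps (a : R) (c d : C) :
  sig eps (a%:C * c + d) = a%:C * sig eps c + sig eps d.
Proof.
case: c d => [u v] [s t]; apply/eqP; rewrite eq_complex /=; apply/andP.
by split; apply/eqP; ring.
Qed.
Lemma sig0 eps : sig eps 0 = 0 :> C.
Proof. by rewrite /sig /= mulr0. Qed.
Lemma sig1 eps : sig eps 1 = 1 :> C.
Proof. by rewrite /sig /= mulr0. Qed.
Lemma sigN eps (c : C) : sig eps (- c) = - sig eps c.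
Proof. by case: c => u v; rewrite /sig /= mulrN. Qed.
Lemma sigN1_i (c : C) : sig (-1) ('i%C * c) = - 'i%C * sig (-1) c.
Proof.
case: c => u v; apply/eqP; rewrite eq_complex /=; apply/andP.
by split; apply/eqP; ring.
Qed.
(** For eps^2 = 1 the map sig is multiplicative and involutive. *)
Lemma sigM eps (c d : C) : eps * eps = 1 ->
  sig eps (sig eps c * d) = c * sig eps d.
Proof.
move=> e; case: c d => [u v] [s t]; apply/eqP; rewrite eq_complex /=; apply/andP.
split; apply/eqP; rewrite ?mulrDr ?mulrA ?e; ring: e.
Qed.
Lemma sigK eps : eps * eps = 1 -> involutive (sig eps).
Proof. by move=> e [u v]; rewrite /sig /= mulrA e mul1r. Qed.
Lemma sig_Re0 eps (c : C) : sig eps c = 0 -> Re c = 0.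
Proof. by case. Qed.
End Sigma.

(** The linear form whose kernel contains the centralizers, as needed by
    [indecomposableI]. *)
Definition re_pos0 (R : rcfType) n (x : real_phase R n.+1) : R := Re (pos x 0).

Fact re_pos0_scalar (R : rcfType) n : scalar (@re_pos0 R n).
Proof.
move=> a x y; rewrite /re_pos0 -[a *: x + y]/(a%:C *: (x : phase R n.+1) + y).
by rewrite posD posZ ReD ReZ.
Qed.
HB.instance Definition _ (R : rcfType) n :=
  GRing.isLinear.Build R (real_phase R n.+1) R _ (@re_pos0 R n)
    (@re_pos0_scalar R n).

(** * The chain algebras, of step 2k + 1 and 2k + 2 *)

Section Chain.
Variables (R : rcfType) (n k : nat) (ev : bool) (eps : R).
Hypothesis kn : (k <= n)%N.
Hypothesis k_gt0 : ~~ ev -> (0 < k)%N.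
Hypothesis eps2 : ~~ ev -> eps * eps = 1.
Local Notation C := R[i].
Local Notation phase := (phase R n.+1).
Local Notation s := (sig eps).
Implicit Types (x y z u : phase) (c : C) (j l : nat).

(** The two parities differ only in the arrows between the indices 0 and 1:
    q_0 -> q_1 and p_1 -> p_0 belong to N when ev holds. *)
Definition chain_link j := ev || (j != 1%N).

Definition chS : 'M[C]_n.+1 :=
  \matrix_(l, j) [&& l.+1 == j, (j <= k)%N & chain_link j]%:R.
Definition chE : 'M[C]_n.+1 :=
  \matrix_(l, j) ((l == j) && (k <= j)%N)%:R.

Local Notation N := (spN chS chE).
Local Notation P := (spP (inord 0 : 'I_n.+1)).

Lemma pos_chN x j : (j <= n)%N ->
  pos (N x) j = if [&& (0 < j)%N, (j <= k)%N & chain_link j] then pos x j.-1 else 0.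
Proof.
move=> jn; apply: pos_spN; split=> [|l]; first by lia.
by rewrite mxE inordK //; case: j jn => [|j] jn; rewrite ?andbF // eqSS.
Qed.

Lemma mom_chN x j : (j <= n)%N ->
  mom (N x) j = (if (k <= j)%N then pos x j else 0) -
                (if (j < k)%N && chain_link j.+1 then mom x j.+1 else 0).
Proof.
move=> jn; apply: mom_spN; (split=> [|l]; last rewrite mxE ?inordK //) => //.
- by rewrite -val_eqE /= inordK //; case: eqP => [->|].
- by lia.
- by rewrite eq_sym; case: eqP => [->|].
Qed.

Lemma mom_chP x j : (j <= n)%N -> mom (P x) j = (j == 0%N)%:R * pos x 0.
Proof. by move=> jn; rewrite mom_spP. Qed.

Definition chcN x := s (pos x 0).
Definition chcP x := if ev then 0 else s (mom x 1).

Lemma pos_chN0 x : pos (N x) 0 = 0.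
Proof. by rewrite pos_chN. Qed.

Fact chE_sym : chE^T = chE.
Proof. by apply/matrixP=> l j; rewrite !mxE eq_sym; case: eqP => [->|]. Qed.
Fact chcN_lin : real_linear chcN.
Proof. by move=> a x y; rewrite /chcN posD posZ sig_linear. Qed.
Fact chcP_lin : real_linear chcP.
Proof.
move=> a x y; rewrite /chcP momD momZ sig_linear.
by case: ifP; rewrite ?mulr0 ?addr0.
Qed.
Fact chPN x : P (N x) = 0.
Proof.
by apply: phaseP => j jn; rewrite pos_spP mom_chP // pos_chN0 mulr0 pos0 mom0.
Qed.
Fact chNP x : N (P x) = 0.
Proof.
apply: phaseP => j jn; rewrite pos_chN // mom_chN // !pos_spP pos0 mom0 !if_same.
split=> //; rewrite sub0r; case: ifP => [/andP[jk _]|_]; last by rewrite oppr0.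
by rewrite mom_chP ?mul0r ?oppr0 //; lia.
Qed.
Fact chcN_N x : chcN (N x) = 0.
Proof. by rewrite /chcN pos_chN0 sig0. Qed.
Fact chcN_P x : chcN (P x) = 0.
Proof. by rewrite /chcN pos_spP sig0. Qed.
Fact chcP_P x : chcP (P x) = 0.
Proof.
rewrite /chcP; case: (boolP ev) => // /k_gt0 k0.
by rewrite mom_chP ?mul0r ?sig0 //; lia.
Qed.
(** Both sides are multiples of p_0, with coefficient (up to sign) the product
    of the q_0-coordinates of x and z by a term in y: this is where s(s(c) d)
    = c s(d), hence eps^2 = 1, is used in the odd case. In the even case both
    are 0. *)
Fact chcP_N x y z :
  chcP (N (chcN x *: y)) *: P z = chcP (N (chcN z *: y)) *: P x.
Proof.
apply: (eq_scale_spP (leq0n n)); rewrite /chcP; case: (boolP ev) => e.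
  by rewrite !mul0r.
rewrite !mom_spNZ /chcN !sigM; try exact: eps2.
by ring.
Qed.

Definition chain : shear R n.+1 :=
  Shear chE_sym chcN_lin chcP_lin chPN chNP chcN_N chcN_P chcP_P chcP_N.

Notation g := (shear_algebra chain).

Lemma pos_chlie (x y : g) j :
  pos [lie x, y] j = s (pos x 0) * pos (N y) j - s (pos y 0) * pos (N x) j.
Proof. exact: pos_lie. Qed.

Lemma mom_chlie (x y : g) j : (j <= n)%N -> mom [lie x, y] j =
  (s (pos x 0) * mom (N y) j + chcP x * ((j == 0%N)%:R * pos y 0)) -
  (s (pos y 0) * mom (N x) j + chcP y * ((j == 0%N)%:R * pos x 0)).
Proof. by move=> jn; rewrite -!mom_chP //; exact: mom_lie. Qed.

(** The weight of a basis vector is its depth in the lower central series. Along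
    q_0, q_1, ..., q_k, p_k, ..., p_0 it increases by one at each arrow; in the
    odd case q_1 is not a bracket, so that the count starts one vector later.
    The side pairs q_j -> p_j with j > k have weights 0 and 1. *)
Definition chain_wpos j := if (j <= k)%N then (j - ~~ ev)%N else 0%N.
Definition chain_wmom j := if (j <= k)%N then ((2 * k).+1 - j - ~~ ev)%N else 1%N.
Definition chain_filt l (x : g) := forall j, (j <= n)%N ->
  ((chain_wpos j < l)%N -> pos x j = 0) /\ ((chain_wmom j < l)%N -> mom x j = 0).

Definition chain_length := ((2 * k).+1 + ev)%N.

Lemma chain_filt_all x : chain_filt 0 x. Proof. by []. Qed.
Lemma chain_filt_zero l : chain_filt l 0. Proof. by move=> j _; rewrite pos0 mom0. Qed.
Lemma chain_filt_linear l (a : R) (x y : g) :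
  chain_filt l x -> chain_filt l y -> chain_filt l (a *: x + y).
Proof.
move=> fx fy j jn; have [px mx] := fx _ jn; have [py my] := fy _ jn.
rewrite -[a *: x + y]/(a%:C *: (x : phase) + y) posD posZ momD momZ.
by split=> h; rewrite ?(px h) ?(py h) ?(mx h) ?(my h) mulr0 addr0.
Qed.

Lemma chain_filtN l x : chain_filt l x -> chain_filt l.+1 (N x).
Proof.
move=> fx j jn; rewrite pos_chN // mom_chN //; split=> h.
  case: (boolP [&& _, _ & _]) => // /and3P[j0 jk lj].
  apply: (proj1 (fx j.-1 _)); first by lia.
  move: h lj; rewrite /chain_wpos jk (leq_trans (leq_pred j) jk) /chain_link.
  by case: (ev) => /=; lia.
have -> : (if (k <= j)%N then pos x j else 0) = 0.
  case: (leqP k j) => // kj; apply: (proj1 (fx j jn)).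
  move: h k_gt0; rewrite /chain_wpos /chain_wmom.
  by case: (leqP j k); case: (ev) => /=; lia.
case: (boolP (_ && _)) => [/andP[jk lj]|_]; last by rewrite subr0.
rewrite sub0r (proj2 (fx j.+1 _)) ?oppr0 //; first by lia.
move: h lj; rewrite /chain_wmom jk (ltnW jk) /chain_link.
by case: (ev) => /=; lia.
Qed.

Lemma chain_filt1N x : chain_filt 1 (N x).
Proof. exact/chain_filtN/chain_filt_all. Qed.

(** N raises weights by [chain_filtN]. The terms of A(y) x come from the
    coordinates of y on q_0, which has weight 0, and on p_1, whose weight is one
    less than that of p_0. *)
Lemma chain_filt_lie l (x y : g) : chain_filt l y -> chain_filt l.+1 [lie x, y].
Proof.
move=> fy.
have y00 : (0 < l)%N -> pos y 0 = 0.
  by move=> l0; apply: (proj1 (fy 0%N _)); rewrite // /chain_wpos leq0n sub0n.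
move=> j jn; rewrite pos_chlie mom_chlie //; have [p m] := chain_filtN fy jn.
have [p0 m0] : ((chain_wpos j < l.+1)%N -> s (pos y 0) * pos (N x) j = 0) /\
               ((chain_wmom j < l.+1)%N -> s (pos y 0) * mom (N x) j = 0).
  case: (posnP l) => [l0|/y00->]; last by rewrite sig0 !mul0r.
  have [p1 m1] := chain_filt1N x jn; rewrite l0.
  by split=> h; [rewrite (p1 h) mulr0 | rewrite (m1 h) mulr0].
split=> h; first by rewrite (p h) (p0 h) mulr0 subr0.
rewrite (m h) (m0 h) mulr0 !add0r; case: j jn {p m p0 m0} h => [|j] jn h; last first.
  by rewrite !mul0r !mulr0 subr0.
rewrite /chcP; case: (boolP ev) => e; first by rewrite !mul0r subr0.
have := k_gt0 e; move: h; rewrite /chain_wmom leq0n e subn0 subn1 /= => h k0.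
rewrite (proj2 (fy 1%N _)) ?sig0 ?mul0r ?subr0; first last.
- by rewrite /chain_wmom k0 e; lia.
- by lia.
by rewrite y00 ?mulr0 //; lia.
Qed.

Lemma chain_filt_eq0 x : chain_filt chain_length x -> x = 0.
Proof.
move=> fx; apply: phaseP => j jn; have [p m] := fx _ jn.
rewrite pos0 mom0 p ?m //; move: k_gt0;
  rewrite /chain_wmom /chain_wpos /chain_length;
  by case: (leqP j k); case: (ev) => /=; lia.
Qed.

Lemma chain_filt_J l x : chain_filt l x -> chain_filt l (shear_J chain x).
Proof.
move=> fx j jn; have [p m] := fx _ jn; rewrite shear_JE posZ momZ.
by split=> h; rewrite ?(p h) ?(m h) mulr0.
Qed.

Lemma chain_lie_filtration : lie_filtration (chain_filt : nat -> g -> Prop).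
Proof.
split; [exact: chain_filt_all | exact: chain_filt_zero | |].
  exact: chain_filt_linear.
exact: chain_filt_lie.
Qed.

Lemma chain_nilpotent_cs : nilpotent_cs (shear_J chain).
Proof.
refine (@filtration_nilpotent_cs _ g _ chain_lie_filtration (shear_J chain)
  chain_length _ _).
- exact: chain_filt_J.
- exact: chain_filt_eq0.
Qed.

Notation q0 := (pos_unit R n 0%N).
Notation q1 := (pos_unit R n 1%N).

Lemma chcP_q a : chcP (pos_unit R n a) = 0.
Proof. by rewrite /chcP mom_pos_unit sig0 if_same. Qed.

Lemma pos_lie_q0 (x : g) j : pos x 0 = 0 -> (j <= n)%N ->
  pos [lie (q0 : g), x] j = pos (N x) j.
Proof.
by move=> x0 jn; rewrite pos_chlie x0 pos_pos_unit // sig1 sig0 mul1r mul0r subr0.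
Qed.

Lemma mom_lie_q0 (x : g) j : pos x 0 = 0 -> (j <= n)%N ->
  mom [lie (q0 : g), x] j = mom (N x) j - chcP x * (j == 0%N)%:R.
Proof.
move=> x0 jn; rewrite mom_chlie // x0 pos_pos_unit // sig1 sig0 chcP_q.
by rewrite mul1r !mul0r addr0 add0r mulr1.
Qed.

Definition chain_vec l : phase :=
  if (l <= k)%N then pos_unit R n l else mom_unit R n ((2 * k).+1 - l)%N.

Lemma pos_chain_vec l j : (j <= n)%N ->
  pos (chain_vec l) j = ((l <= k)%N && (j == l))%:R.
Proof.
move=> jn; rewrite /chain_vec; case: (leqP l k) => _; first exact: pos_pos_unit.
exact: pos_mom_unit.
Qed.

Lemma mom_chain_vec l j : (j <= n)%N ->
  mom (chain_vec l) j = ((k < l)%N && (j == (2 * k).+1 - l)%N)%:R.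
Proof.
move=> jn; rewrite /chain_vec; case: (leqP l k) => _; first exact: mom_pos_unit.
exact: mom_mom_unit.
Qed.

Lemma chain_vec_neq0 l c : (l <= (2 * k).+1)%N -> c != 0 -> c *: chain_vec l <> 0.
Proof.
move=> lk c0 cl0; move/eqP: c0; apply; case: (leqP l k) => h.
  have := congr1 (fun u => pos u l) cl0.
  by rewrite posZ pos0 pos_chain_vec ?h ?eqxx ?mulr1 //; lia.
have := congr1 (fun u => mom u ((2 * k).+1 - l)%N) cl0.
by rewrite momZ mom0 mom_chain_vec ?h ?eqxx ?mulr1 //; lia.
Qed.

Lemma sig_neq0 c : ~~ ev -> c != 0 -> s c != 0.
Proof.
by move=> e; apply: contraNneq => sc; rewrite -(sigK (eps2 e) c) sc sig0.
Qed.

(** The coefficient changes along the chain: sign changes come from the block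
    -S^T of N, and in the odd case the last arrow applies sig. It is enough to
    know that it does not vanish. *)
Lemma lie_chain_vec l c : (0 < l <= 2 * k)%N -> c != 0 -> exists2 c', c' != 0 &
  [lie (q0 : g), (c *: chain_vec l : phase)] = c' *: chain_vec l.+1 :> phase.
Proof.
move=> /andP[l0 lk] c0.
have posx j : (j <= n)%N -> pos (c *: chain_vec l) j = c * ((l <= k)%N && (j == l))%:R.
  by move=> jn; rewrite posZ pos_chain_vec.
have momx j : (j <= n)%N ->
    mom (c *: chain_vec l) j = c * ((k < l)%N && (j == (2 * k).+1 - l)%N)%:R.
  by move=> jn; rewrite momZ mom_chain_vec.
have x0 : pos (c *: chain_vec l) 0 = 0.
  by rewrite posx // (_ : (0%N == l) = false) ?andbF ?mulr0 //; lia.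
have cPx : chcP (c *: chain_vec l) = if ~~ ev && (l == 2 * k)%N then s c else 0.
  rewrite /chcP; case: (boolP ev) => e //=; have k0 := k_gt0 e.
  rewrite momx; last by lia.
  case: (eqVneq l (2 * k)%N) => [e1|ne].
    rewrite (_ : _ && _ = true) ?mulr1 //; lia.
  rewrite (_ : _ && _ = false) ?mulr0 ?sig0 //; lia.
pose c' := if (l <= k)%N then c else if ~~ ev && (l == 2 * k)%N then - s c else - c.
exists c'.
  rewrite /c'; case: (leqP l k) => // _; case: (boolP (_ && _)) => [/andP[e _]|_].
    by rewrite oppr_eq0 sig_neq0.
  by rewrite oppr_eq0.
apply: phaseP => j jn; rewrite (pos_lie_q0 x0 jn) (mom_lie_q0 x0 jn) cPx.
rewrite posZ momZ pos_chain_vec // mom_chain_vec // pos_chN // mom_chN //.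
split.
  case: (boolP ((l < k)%N && (j == l.+1))) => [/andP[lk' /eqP jl]|h].
    have -> : [&& (0 < j)%N, (j <= k)%N & chain_link j] by rewrite /chain_link; lia.
    rewrite posx; last by lia.
    by rewrite jl /= eqxx /c' (ltnW lk').
  rewrite mulr0; case: (boolP [&& _, _ & _]) => // h'.
  rewrite posx; last by lia.
  by rewrite (_ : _ && _ = false) ?mulr0 //; lia.
have -> : (if (k <= j)%N then pos (c *: chain_vec l) j else 0) =
          c * ((l == k) && (j == k))%:R.
  case: (leqP k j) => kj; last by rewrite (_ : _ && _ = false) ?mulr0 //; lia.
  by rewrite posx //; congr (_ * _%:R); lia.
have -> : (if (j < k)%N && chain_link j.+1 then mom (c *: chain_vec l) j.+1 else 0) =
          c * [&& (k < l)%N, (j == 2 * k - l)%N & chain_link j.+1]%:R.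
  case: (boolP (_ && _)) => h.
    rewrite momx; last by lia.
    by congr (_ * _%:R); move: h; rewrite /chain_link; lia.
  by rewrite (_ : [&& _, _ & _] = false) ?mulr0 //; move: h; rewrite /chain_link; lia.
have -> : (j == (2 * k).+1 - l.+1)%N = (j == 2 * k - l)%N by rewrite subSS.
rewrite /c'; case: (ltngtP l k) => lk'.
- rewrite (_ : (l == 2 * k)%N = false) ?andbF /=; last by lia.
  by rewrite ltnS leqNgt lk' /= !mulr0 mul0r !subr0.
- rewrite ltnS (ltnW lk') /=.
  case: (boolP (~~ ev && _)) => [/andP[e /eqP e2]|h].
    rewrite e2 subnn /chain_link (negPf e) /=; case: (eqVneq j 0%N) => [->|_] /=.
      by rewrite !mulr0 !sub0r oppr0 add0r !mulr1.
    by rewrite !mulr0 !subr0.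
  rewrite mul0r subr0 mulr0 sub0r mulNr; congr (- (_ * _%:R)).
  by move: h; rewrite /chain_link; case: (eqVneq j (2 * k - l)%N) => // -> /=; lia.
rewrite lk' ltnSn (_ : (k == 2 * k)%N = false) ?andbF /=; last by lia.
rewrite (_ : (2 * k - k)%N = k); last by lia.
by rewrite !mulr0 mul0r !subr0.
Qed.

Lemma chain_abelian : eps = -1 -> abelian_cs (shear_J chain).
Proof.
move=> e; apply: shear_abelian => x /=.
  by rewrite /chcN posZ e sigN1_i.
by rewrite /chcP; case: (ev); rewrite ?mulr0 // momZ e sigN1_i.
Qed.

Lemma pos_lie_q01 c d j :
  pos [lie (c *: q0 : g), (d *: q1 : g)] j = s c * (d * pos (N q1) j).
Proof.
rewrite (pos_chlie (c *: q0) (d *: q1)) (posZ c q0) (posZ d q1) !pos_pos_unit //.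
by rewrite mulr1 mulr0 sig0 mul0r subr0 pos_spNZ.
Qed.

Lemma mom_lie_q01 c d j : (0 < j <= n)%N ->
  mom [lie (c *: q0 : g), (d *: q1 : g)] j = s c * (d * mom (N q1) j).
Proof.
case/andP=> j0 jn; rewrite (mom_chlie (c *: q0) (d *: q1) jn) (gtn_eqF j0).
rewrite (posZ c q0) (posZ d q1) !pos_pos_unit //.
by rewrite mulr1 mulr0 sig0 !mul0r !mulr0 !addr0 subr0 mom_spNZ.
Qed.

Lemma iter_lie_chain_vec l c : (l <= 2 * k)%N -> c != 0 ->
  exists2 c', c' != 0 & iter l (lie_bracket (q0 : g)) (c *: chain_vec 1 : phase) =
                        c' *: chain_vec l.+1 :> phase.
Proof.
elim: l => [|l IHl] lk c0; first by exists c.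
have [c1 c10 E1] := IHl (ltnW lk) c0.
have [c2 c20 E2] := @lie_chain_vec l.+1 c1 lk c10.
exists c2; first exact: c20.
exact: etrans (congr1 (lie_bracket (q0 : g)) E1) E2.
Qed.

(** In the even case N q_0 = q_1 is not itself a bracket, but this multiple of
    it is; the factor vanishes only for eps = 1. *)
Lemma lie_q0_iq0 : ev -> [lie (q0 : g), ('i%C *: q0 : phase)] =
  ('i%C - s 'i%C) *: chain_vec 1 :> phase.
Proof.
move=> e; apply: phaseP => j jn; rewrite (pos_chlie q0 ('i%C *: q0)).
rewrite (mom_chlie q0 ('i%C *: q0) jn) chcP_q pos_spNZ mom_spNZ (posZ _ q0).
rewrite (pos_pos_unit _ _ (leq0n n)) sig1 !mul1r mul0r addr0 eqxx !mulr1.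
rewrite posZ momZ.
have -> : pos (N q0) j = pos (chain_vec 1) j.
  rewrite pos_chN // pos_chain_vec //.
  case: (boolP [&& _, _ & _]) => h.
    rewrite pos_pos_unit; last by lia.
    by congr (_%:R); move: h; lia.
  by rewrite (_ : _ && _ = false) //; move: h; rewrite /chain_link e; lia.
have -> : mom (N q0) j = mom (chain_vec 1) j.
  rewrite mom_chN // mom_chain_vec // mom_pos_unit if_same subr0.
  case: (leqP k j) => h.
    by rewrite pos_pos_unit //; congr (_%:R); lia.
  by rewrite (_ : _ && _ = false) //; lia.
by rewrite /chcP e mul0r addr0 !mulrBl.
Qed.

Lemma chain_step : (ev -> eps != 1) -> nilpotent_of_step g chain_length.
Proof.
move=> eps1.
have h x : iter chain_length.-1 (lie_bracket (q0 : g)) x <> 0 ->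
    nilpotent_of_step g chain_length.
  refine (filtration_step chain_lie_filtration _ _).
    by rewrite /chain_length addSn.
  exact: chain_filt_eq0.
case: (boolP ev) => e.
  apply: (h ('i%C *: q0 : phase)).
  have -> : chain_length.-1 = (2 * k).+1 by rewrite /chain_length e addn1.
  have c0 : 'i%C - s 'i%C != 0.
    rewrite eq_complex /= subrr eqxx mulr1 subr_eq0 eq_sym.
    exact: eps1.
  have [c' c'0 E] := iter_lie_chain_vec (leqnn _) c0.
  rewrite iterSr => E'; apply: (@chain_vec_neq0 (2 * k).+1 c') => //.
  rewrite -E -[RHS]E'; congr iter; exact: esym (lie_q0_iq0 e).
apply: (h (1 *: chain_vec 1 : phase)).
have -> : chain_length.-1 = (2 * k)%N by rewrite /chain_length (negPf e) addn0.
have [c' c'0 E] := iter_lie_chain_vec (leqnn _) (oner_neq0 _).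
by rewrite E => E'; apply: (@chain_vec_neq0 (2 * k).+1 c').
Qed.
Section ChainIndecomposable.
Hypothesis k0 : (0 < k)%N.

(** N q_1 is q_2, or p_1 when k = 1: the index is positive in both cases, which
    keeps the contribution of P, located at p_0, out of the way. *)
Lemma chN_q1 : exists2 j, (0 < j <= n)%N & pos (N q1) j = 1 \/ mom (N q1) j = 1.
Proof.
have n0 : (0 < n)%N by lia.
case: (leqP 2 k) => k2.
  exists 2%N; first by lia.
  left; rewrite pos_chN; last by lia.
  by rewrite k2 /chain_link orbT /= (@pos_pos_unit R n 1 1 n0).
exists 1%N => //; right; rewrite mom_chN // -ltnS k2 ltnNge -ltnS k2 /=.
by rewrite (@pos_pos_unit R n 1 1 n0) subr0.
Qed.

(** [q_0, q_1] = N q_1, while [i q_0, i q_1] = s(i) i N q_1 = -eps N q_1. *)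
Lemma chain_not_abelian : eps != -1 -> ~ abelian_cs (shear_J chain).
Proof.
move=> eN1 ab.
have e : [lie (q0 : g), (q1 : g)] = [lie ('i%C *: q0 : g), ('i%C *: q1 : g)].
  apply: (etrans (ab q0 q1)).
  exact: (f_equal2 (@lie_bracket _ g) (shear_JE (q0 : g)) (shear_JE (q1 : g))).
have p10 : pos q1 0 = 0 by rewrite pos_pos_unit.
have E : 1 = s 'i%C * ('i%C * 1).
  have [j /andP[j0 jn] [h|h]] := chN_q1.
    have := etrans (esym (pos_lie_q0 p10 jn))
      (etrans (congr1 (fun u : phase => pos u j) e) (pos_lie_q01 'i%C 'i%C j)).
    by rewrite h; apply.
  have jn' : (0 < j <= n)%N by rewrite j0.
  have := etrans (esym (mom_lie_q0 p10 jn))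
    (etrans (congr1 (fun u : phase => mom u j) e) (@mom_lie_q01 'i%C 'i%C j jn')).
  by rewrite h (gtn_eqF j0) mulr0 subr0; apply.
move/eqP: E; rewrite mulr1 eq_complex /= => /andP[/eqP e1 _].
by move/eqP: eN1; apply; lra.
Qed.

(** [q_1, x] = -s(x_0) N q_1, where x_0 is the q_0-coordinate of x. *)
Lemma centralizer_q1 (x : g) : [lie (q1 : g), x] = 0 -> s (pos x 0) = 0.
Proof.
move=> e; have q10 : pos q1 0 = 0 by rewrite pos_pos_unit.
have [j /andP[j0 jn] [h|h]] := chN_q1.
  have := etrans (esym (pos_chlie q1 x j)) (congr1 (fun u : phase => pos u j) e).
  rewrite q10 sig0 h mul0r sub0r mulr1 pos0 => /eqP.
  by rewrite oppr_eq0 => /eqP.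
have := etrans (esym (mom_chlie q1 x jn)) (congr1 (fun u : phase => mom u j) e).
rewrite q10 sig0 h (gtn_eqF j0) chcP_q !mul0r !mulr0 add0r addr0 sub0r mulr1 mom0.
by move/eqP; rewrite oppr_eq0 => /eqP.
Qed.

Lemma chcP_pos0 x y : s (pos y 0) = 0 -> chcP x * pos y 0 = 0.
Proof.
rewrite /chcP; case: (boolP ev) => e sy; first by rewrite mul0r.
by rewrite -(sigK (eps2 e) (pos y 0)) sy sig0 mulr0.
Qed.

Lemma mom_chlie_ker (a y : g) j : s (pos a 0) = 0 -> (j <= n)%N ->
  mom [lie a, y] j =
    (j == 0%N)%:R * (chcP a * pos y 0) - s (pos y 0) * mom (N a) j.
Proof.
move=> sa jn; rewrite mom_chlie // sa mul0r add0r.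
by rewrite [chcP y * _]mulrCA (chcP_pos0 y sa) mulr0 addr0 mulrCA.
Qed.

Lemma pos_chlie_ker (a y : g) j : s (pos a 0) = 0 ->
  pos [lie a, y] j = - (s (pos y 0) * pos (N a) j).
Proof. by move=> sa; rewrite pos_chlie sa mul0r sub0r. Qed.

(** For a in the centralizer of q_1 the bracket [a, y] is
    chcP(a) P y - s(y_0) N a. When s(y_0) <> 0 its vanishing forces N a = 0 and
    chcP(a) = 0, because in the odd case p_0 is not in the image of N and in the
    even case chcP is 0; and such an a is central. *)
Lemma chain_centralizer (a : g) : s (pos a 0) = 0 ->
  (forall y, [lie a, y] = 0) \/ (forall y, [lie a, y] = 0 -> re_pos0 y = 0).
Proof.
move=> sa; case: (boolP ((N a == 0) && (chcP a == 0))) => [/andP[/eqP Na /eqP Pa]|h].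
  left=> y; apply: phaseP => j jn; rewrite pos_chlie_ker // mom_chlie_ker //.
  by rewrite Na Pa !pos0 !mom0 mul0r !mulr0 subrr oppr0.
right=> y e; apply: (@sig_Re0 _ eps); apply/eqP; apply: contraNT h => sy.
have pN j : (j <= n)%N -> pos (N a) j = 0.
  move=> jn; have := congr1 (fun u : phase => pos u j) e.
  rewrite pos_chlie_ker // pos0 => /eqP.
  by rewrite oppr_eq0 mulf_eq0 (negPf sy) => /eqP.
have mN j : (0 < j <= n)%N -> mom (N a) j = 0.
  case/andP=> j0 jn; have := congr1 (fun u : phase => mom u j) e.
  rewrite mom_chlie_ker // mom0 (gtn_eqF j0) mul0r sub0r => /eqP.
  by rewrite oppr_eq0 mulf_eq0 (negPf sy) => /eqP.
have := congr1 (fun u : phase => mom u 0) e.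
rewrite mom_chlie_ker // mom0 eqxx mul1r => e0.
have [m0 P0] : mom (N a) 0 = 0 /\ chcP a = 0.
  case: (boolP ev) => ee.
    have P0 : chcP a = 0 by rewrite /chcP ee.
    split=> //; apply/eqP; move/eqP: e0.
    by rewrite P0 mul0r sub0r oppr_eq0 mulf_eq0 (negPf sy).
  have m0 : mom (N a) 0 = 0.
    by rewrite mom_chN // leqNgt k0 /chain_link (negPf ee) /= subr0.
  split=> //; move/eqP: e0; rewrite m0 mulr0 subr0 mulf_eq0 => /orP[/eqP//|/eqP y0].
  by move: sy; rewrite y0 sig0 eqxx.
rewrite P0 eqxx andbT; apply/eqP; apply: phaseP => j jn.
rewrite pos0 mom0 pN //; split=> //.
by case: j jn => [|j] jn //; apply: mN.
Qed.

(** A central x is a combination of p_0 and of the p_j with j > k, and each of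
    these is reached by ad(q_0): from p_1 and from q_j respectively. The
    coefficient on p_1 is chosen to undo the last arrow of the chain. *)
Lemma chain_center (x : g) : (forall y, [lie x, y] = 0) -> x \in lcs g 1.
Proof.
move=> xc.
have cx (y : g) : [lie y, x] = 0 by rewrite lieC xc oppr0.
have sx := centralizer_q1 (cx q1).
have p00 : pos q0 0 = 1 by rewrite pos_pos_unit.
have pN j : (j <= n)%N -> pos (N x) j = 0.
  move=> jn; have := congr1 (fun u : phase => pos u j) (xc q0).
  rewrite (pos_chlie_ker q0 j sx) p00 sig1 mul1r pos0 => /eqP.
  by rewrite oppr_eq0 => /eqP.
have mN0 j : (j <= n)%N -> mom (N x) j = (j == 0%N)%:R * chcP x.
  move=> jn; have := congr1 (fun u : phase => mom u j) (xc q0).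
  rewrite (mom_chlie_ker q0 sx jn) p00 sig1 mul1r mulr1 mom0 => /eqP.
  by rewrite subr_eq0 => /eqP.
have Px : chcP x = 0.
  rewrite /chcP; case: (boolP ev) => // e.
  have := mN0 0%N (leq0n n).
  rewrite mom_chN // leqNgt k0 /chain_link (negPf e) /= subr0.
  by rewrite mul1r /chcP (negPf e).
have mN j : (j <= n)%N -> mom (N x) j = 0 by move=> jn; rewrite mN0 // Px mulr0.
have xp j : (j <= n)%N -> pos x j = 0.
  move=> jn; case: (leqP k j) => kj.
    by have := mN _ jn; rewrite mom_chN // kj ltnNge kj /= subr0.
  have jn' : (j < n)%N by lia.
  have := pN _ jn'; rewrite pos_chN // kj /= /chain_link.
  case: (boolP ev) => e //=; case: j {jn jn'} kj => [|j] // _ _.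
  by rewrite -(sigK (eps2 e) (pos x 0)) sx sig0.
have xm j : (0 < j <= k)%N -> mom x j = 0.
  case: j => // j /= jk; have jn : (j <= n)%N by lia.
  have := mN _ jn; rewrite mom_chN // leqNgt jk /= sub0r /chain_link.
  case: (boolP ev) => e /=; first by move/eqP; rewrite oppr_eq0 => /eqP.
  case: j jk {jn} => [|j] jk /=; last by move/eqP; rewrite oppr_eq0 => /eqP.
  move: Px; rewrite /chcP (negPf e) => s1 _.
  by rewrite -(sigK (eps2 e) (mom x 1)) s1 sig0.
pose d := if ev then mom x 0 else s (mom x 0).
pose w := of_coords n (fun j => if (k < j)%N then mom x j else 0)
                      (fun j => - ((j == 1%N)%:R * d)).
have w0 : pos w 0 = 0 by rewrite pos_of.
have -> : x = [lie (q0 : g), (w : g)]; last by rewrite memv_lie ?memvf.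
apply: phaseP => j jn; rewrite (pos_lie_q0 w0 jn) (mom_lie_q0 w0 jn).
rewrite pos_chN // mom_chN // xp //; split.
  case: (boolP [&& _, _ & _]) => // h; rewrite pos_of; last by lia.
  by rewrite (_ : (k < j.-1)%N = false) //; lia.
case: (posnP j) => [j0|j0]; last first.
  rewrite mulr0 subr0; case: (ltngtP j k) => jk.
  - rewrite xm ?j0 ?(ltnW jk) //= sub0r; case: chain_link; rewrite ?oppr0 //.
    rewrite mom_of; last by lia.
    by rewrite eqSS (gtn_eqF j0) mul0r !oppr0.
  - by rewrite /= subr0 pos_of // jk.
  - by rewrite /= subr0 pos_of // jk ltnn xm // k0 /=.
have w1 : mom w 1 = - d by rewrite mom_of ?eqxx ?mul1r //; lia.
rewrite j0 leqNgt k0 mulr1 w1 /chain_link /chcP w1 /d /=.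
case: (boolP ev) => e /=; first by rewrite sub0r subr0 opprK.
by rewrite !sub0r oppr0 add0r sigN opprK (sigK (eps2 e)).
Qed.

Lemma chain_indecomposable : indecomposable g.
Proof.
apply: (@indecomposableI _ g q1 (@re_pos0 R n : {scalar g}) q0).
- move=> x y /centralizer_q1 sx /centralizer_q1 sy.
  apply: phaseP => j jn; rewrite pos_chlie_ker // mom_chlie_ker //.
  by rewrite chcP_pos0 // sy mulr0 !mul0r subrr oppr0 pos0 mom0.
- by move=> a /centralizer_q1; exact: chain_centralizer.
- rewrite /= /re_pos0 pos_pos_unit //=; apply/eqP; exact: oner_neq0.
- exact: chain_center.
Qed.

End ChainIndecomposable.
End Chain.

(** * An indecomposable algebra of step 2 *)

Section TwoStep.
Variables (R : rcfType) (n : nat) (eps : R).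
Hypothesis n_gt0 : (0 < n)%N.
Local Notation C := R[i].
Local Notation phase := (phase R n.+1).
Local Notation s := (sig eps).
Local Notation conj := (sig (-1)).
Implicit Types (x y z u : phase) (c : C) (j : nat).

(** q_0 is sent to p_1 rather than to p_0, so that [q_0, i q_0] and
    [q_1, i q_1] lie on the same complex line; the matrix E has to be symmetric,
    which then sends q_1 to p_0. *)
Definition swap01 j : nat := if j is 0 then 1%N else if j is 1 then 0%N else j.

Definition tsE : 'M[C]_n.+1 := \matrix_(l, j) (l == swap01 j :> nat)%:R.

Local Notation N := (spN 0 tsE).
Local Notation P := (spP (inord 1 : 'I_n.+1)).

Lemma swap01_lt j : (j <= n)%N -> (swap01 j <= n)%N.
Proof. by case: j => [|[|j]]. Qed.

Lemma pos_tsN x j : pos (N x) j = 0.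
Proof.
by rewrite (@pos_spN _ _ _ _ _ _ 0 false) //; split=> // l; rewrite mxE andbF.
Qed.

Lemma mom_tsN x j : (j <= n)%N -> mom (N x) j = pos x (swap01 j).
Proof.
move=> jn; rewrite (@mom_spN _ _ _ _ _ _ (swap01 j) true 0 false) ?subr0 //.
  by split=> [_|l]; [exact: swap01_lt | rewrite mxE inordK // andbT].
by split=> // l; rewrite mxE andbF.
Qed.

Lemma mom_tsP x j : (j <= n)%N -> mom (P x) j = (j == 1%N)%:R * pos x 1.
Proof. by move=> jn; rewrite mom_spP. Qed.

Definition tscN x := s (pos x 0).
(** The factor i turns [q_1, i q_1] by a right angle: without it that bracket
    would be a real multiple of i p_1, as [q_0, i q_0] is. *)
Definition tscP x := 'i%C * conj (pos x 1).

Fact tsE_sym : tsE^T = tsE.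
Proof.
apply/matrixP=> l j; rewrite !mxE; congr (_%:R).
by move: (val l) (val j) => [|[|a]] [|[|b]] //=; rewrite eq_sym.
Qed.
Fact tscN_lin : real_linear tscN.
Proof. by move=> a x y; rewrite /tscN posD posZ sig_linear. Qed.
Fact tscP_lin : real_linear tscP.
Proof. by move=> a x y; rewrite /tscP posD posZ sig_linear mulrDr mulrCA. Qed.
Fact tsPN x : P (N x) = 0.
Proof.
by apply: phaseP => j jn; rewrite pos_spP mom_tsP // pos_tsN mulr0 pos0 mom0.
Qed.
Fact tsNP x : N (P x) = 0.
Proof. by apply: phaseP => j jn; rewrite pos_tsN mom_tsN // pos_spP pos0 mom0. Qed.
Fact tscN_N x : tscN (N x) = 0. Proof. by rewrite /tscN pos_tsN sig0. Qed.
Fact tscN_P x : tscN (P x) = 0. Proof. by rewrite /tscN pos_spP sig0. Qed.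
Fact tscP_P x : tscP (P x) = 0. Proof. by rewrite /tscP pos_spP sig0 mulr0. Qed.
Fact tscP_N x y z :
  tscP (N (tscN x *: y)) *: P z = tscP (N (tscN z *: y)) *: P x.
Proof.
apply: (eq_scale_spP n_gt0); rewrite /tscP !pos_tsN sig0.
by rewrite mulr0 !mul0r.
Qed.

Definition two_step : shear R n.+1 :=
  Shear tsE_sym tscN_lin tscP_lin tsPN tsNP tscN_N tscN_P tscP_P tscP_N.

Notation g := (shear_algebra two_step).
Local Notation q0 := (pos_unit R n 0%N).
Local Notation q1 := (pos_unit R n 1%N).

Lemma pos_tslie (x y : g) j : pos [lie x, y] j = 0.
Proof. by rewrite [LHS]pos_lie !pos_tsN !mulr0 subr0. Qed.

Lemma mom_tslie (x y : g) j : (j <= n)%N -> mom [lie x, y] j =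
  (s (pos x 0) * pos y (swap01 j) + tscP x * ((j == 1%N)%:R * pos y 1)) -
  (s (pos y 0) * pos x (swap01 j) + tscP y * ((j == 1%N)%:R * pos x 1)).
Proof.
move=> jn; rewrite -!mom_tsP //.
have <- := mom_tsN x jn; have <- := mom_tsN y jn; exact: mom_lie.
Qed.

Lemma mom_tslie0 (x y : g) :
  mom [lie x, y] 0 = s (pos x 0) * pos y 1 - s (pos y 0) * pos x 1.
Proof. by rewrite mom_tslie //= !mul0r !mulr0 !addr0. Qed.

Definition two_step_filt l (x : g) : Prop := match l with
  | 0 => True | 1 => forall j, (j <= n)%N -> pos x j = 0 | _ => x = 0 end.

Lemma two_step_lie_filtration : lie_filtration (two_step_filt : nat -> g -> Prop).
Proof.
split=> //.
- by case=> [|[|l]] //= j _; rewrite pos0.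
- case=> [|[|l]] a x y //= px py; last by rewrite px py scaler0 addr0.
  move=> j jn; rewrite -[a *: x + y]/(a%:C *: (x : phase) + y).
  by rewrite posD posZ px // py // mulr0 addr0.
- case=> [|[|l]] x y //= py.
  + by move=> j jn; exact: pos_tslie.
  + apply: phaseP => j jn; rewrite pos_tslie mom_tslie // pos0 mom0.
    by rewrite /tscP !py ?swap01_lt // !sig0 !(mulr0, mul0r) !addr0 subr0.
  + by rewrite py lie0r.
Qed.

Lemma two_step_nilpotent_cs : nilpotent_cs (shear_J two_step).
Proof.
refine (@filtration_nilpotent_cs _ g _ two_step_lie_filtration (shear_J two_step)
  2 _ _) => //.
case=> [|[|l]] x //=.
  by move=> px j jn; rewrite shear_JE posZ px // mulr0.
by move=> ->; rewrite linear0.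
Qed.

Lemma tscP_q0 : tscP q0 = 0.
Proof. by rewrite /tscP pos_pos_unit // sig0 mulr0. Qed.

Lemma mom_lie_q0_ts (x : g) j : pos x 0 = 0 -> (j <= n)%N ->
  mom [lie (q0 : g), x] j = pos x (swap01 j).
Proof.
move=> x0 jn; rewrite mom_tslie // x0 sig0 tscP_q0.
have p00 : pos q0 0 = 1 by rewrite pos_pos_unit.
have p01 : pos q0 1 = 0 by rewrite pos_pos_unit.
by rewrite p00 p01 sig1 mul1r !(mul0r, mulr0) !addr0 subr0.
Qed.

Lemma mom_lie_scale_q0 c j : (j <= n)%N ->
  mom [lie (q0 : g), (c *: q0 : phase)] j = (c - s c) * (j == 1%N)%:R.
Proof.
move=> jn; rewrite (mom_tslie q0 (c *: q0) jn) tscP_q0 !(posZ c q0).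
have p01 : pos q0 1 = 0 by rewrite pos_pos_unit.
have p00 : pos q0 0 = 1 by rewrite pos_pos_unit.
rewrite p01 p00 !(mulr0, mul0r) !addr0 sig1 mul1r mulr1 -mulrBl.
rewrite pos_pos_unit ?swap01_lt //.
by case: j {jn} => [|[|j]].
Qed.

Lemma mom_lie_scale_q1 c j : (j <= n)%N ->
  mom [lie (q1 : g), (c *: q1 : phase)] j =
  'i%C * (c - conj c) * (j == 1%N)%:R.
Proof.
move=> jn; rewrite (mom_tslie q1 (c *: q1) jn) /tscP !(posZ c q1).
have p10 : pos q1 0 = 0 by rewrite pos_pos_unit.
have p11 : pos q1 1 = 1 by rewrite pos_pos_unit.
by rewrite p10 p11 !mulr0 sig0 sig1 !mul0r !add0r !mulr1; ring.
Qed.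

Lemma two_step_step : eps != 1 -> nilpotent_of_step g 2.
Proof.
move=> eps1.
apply: (@filtration_step _ g _ two_step_lie_filtration 2
  ('i%C *: q0 : phase) q0) => //=.
move=> e; have := congr1 (fun u : phase => mom u 1) e.
rewrite mom_lie_scale_q0 // mom0 eqxx mulr1 => /eqP.
by rewrite eq_complex /= subrr eqxx mulr1 subr_eq0 eq_sym (negPf eps1).
Qed.

Lemma two_step_abelian : eps = -1 -> abelian_cs (shear_J two_step).
Proof.
move=> e; apply: shear_abelian => x /=.
  by rewrite /tscN posZ e sigN1_i.
by rewrite /tscP posZ sigN1_i mulrCA.
Qed.

Lemma two_step_not_abelian : eps != -1 -> ~ abelian_cs (shear_J two_step).
Proof.
move=> eN1 ab.
have e : [lie (q0 : g), (q1 : g)] = [lie ('i%C *: q0 : g), ('i%C *: q1 : g)].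
  apply: (etrans (ab q0 q1)).
  exact: (f_equal2 (@lie_bracket _ g) (shear_JE (q0 : g)) (shear_JE (q1 : g))).
have p10 : pos q1 0 = 0 by rewrite pos_pos_unit.
have p11 : pos q1 1 = 1 by rewrite pos_pos_unit.
have p00 : pos q0 0 = 1 by rewrite pos_pos_unit.
have rhs : mom [lie ('i%C *: q0 : g), ('i%C *: q1 : g)] 0 = s 'i%C * 'i%C.
  apply: etrans (mom_tslie0 ('i%C *: q0) ('i%C *: q1)) _.
  rewrite (posZ _ q0 0) (posZ _ q1 1) (posZ _ q1 0) p10 p11 p00.
  by rewrite !mulr1 mulr0 sig0 mul0r subr0.
have := etrans (esym (mom_lie_q0_ts p10 (leq0n n)))
  (etrans (congr1 (fun u : phase => mom u 0) e) rhs).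
rewrite /= p11; move/eqP; rewrite eq_complex /= => /andP[/eqP e1 _].
by move/eqP: eN1; apply; move: e1; lra.
Qed.

(** The coordinates of [q_1, x] on p_0 and on p_1 are -s(x_0) and
    -2 Im(x_1), for the q-coordinates x_0 and x_1 of x. *)
Lemma centralizer_q1_ts (x : g) : [lie (q1 : g), x] = 0 ->
  s (pos x 0) = 0 /\ Im (pos x 1) = 0.
Proof.
move=> e.
have p10 : pos q1 0 = 0 by rewrite pos_pos_unit.
have p11 : pos q1 1 = 1 by rewrite pos_pos_unit.
have := congr1 (fun u : phase => mom u 0) e.
rewrite (mom_tslie q1 x (leq0n n)) /= p10 p11 sig0 !(mulr0, mul0r) mulr1 !addr0 sub0r.
rewrite mom0 => /eqP; rewrite oppr_eq0 => /eqP s0; split=> //.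
have := congr1 (fun u : phase => mom u 1) e.
rewrite (mom_tslie q1 x n_gt0) /= p10 p11 sig0 /tscP p11 sig1.
rewrite !(mulr0, mul0r, mul1r, mulr1) !add0r mom0.
case: (pos x 1) => a b /eqP; rewrite eq_complex /= => /andP[/eqP e1 _].
by move: e1; lra.
Qed.

Lemma mom_tslie_ker (a y : g) j : s (pos a 0) = 0 -> (j <= n)%N ->
  mom [lie a, y] j =
    (j == 1%N)%:R * (tscP a * pos y 1 - tscP y * pos a 1)
    - s (pos y 0) * pos a (swap01 j).
Proof.
move=> sa jn; rewrite mom_tslie // sa mul0r add0r opprD addrCA addrC mulrBr.
by congr (_ - _ - _); rewrite mulrCA.
Qed.

(** If a has a nonzero position coordinate, the coordinate of [a, y] on the
    corresponding momentum gives s(y_0) = 0; the coordinate on p_1, which also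
    receives P, is used only once the q_1-coordinate of a is known to vanish. *)
Lemma two_step_centralizer (a : g) : s (pos a 0) = 0 ->
  (forall y, [lie a, y] = 0) \/ (forall y, [lie a, y] = 0 -> re_pos0 y = 0).
Proof.
move=> sa.
have [a0|] := boolP [forall j : 'I_n.+1, pos a j == 0].
  have pa j : (j <= n)%N -> pos a j = 0.
    by move=> jn; have /forallP/(_ (Ordinal (jn : j < n.+1)%N))/eqP := a0.
  left=> y; apply: phaseP => j jn; rewrite pos_tslie mom_tslie_ker //.
  rewrite pos0 mom0 /tscP !pa ?swap01_lt //.
  by rewrite sig0 !(mulr0, mul0r) subrr mulr0 subrr.
case/forallPn=> j0 aj0; right=> y e; apply: (@sig_Re0 _ eps); apply/eqP.
apply: contraNT aj0 => sy.
have j0n := leq_ord j0.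
have pj j : (j <= n)%N -> j != 1%N -> pos a (swap01 j) = 0.
  move=> jn j1; have := congr1 (fun u : phase => mom u j) e.
  rewrite mom_tslie_ker // mom0 (negPf j1) mul0r sub0r => /eqP.
  by rewrite oppr_eq0 mulf_eq0 (negPf sy) => /eqP.
have a1 : pos a 1 = 0 by exact: (pj 0%N).
case: (eqVneq (nat_of_ord j0) 0%N) => [->|j00]; last first.
  case: (eqVneq (nat_of_ord j0) 1%N) => [->|j01]; first by rewrite a1.
  have := pj _ j0n j01.
  by move: (nat_of_ord j0) j00 j01 {j0n} => [|[|m]] //= _ _ ->.
have := congr1 (fun u : phase => mom u 1) e.
rewrite mom_tslie_ker // mom0 /tscP a1 sig0 !(mulr0, mul0r) subrr mulr0 sub0r => /eqP.
by rewrite oppr_eq0 mulf_eq0 (negPf sy).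
Qed.

(** A central x has only momentum coordinates. Those other than on p_1 come from
    one bracket with q_0; on p_1 the imaginary part comes from [q_0, a q_0] and
    the real part from [q_1, b q_1], for imaginary a and b. *)
Lemma two_step_center (x : g) : eps != 1 ->
  (forall y, [lie x, y] = 0) -> x \in lcs g 1.
Proof.
move=> eps1 xc.
have [sx _] : s (pos x 0) = 0 /\ Im (pos x 1) = 0.
  by apply: centralizer_q1_ts; rewrite lieC xc oppr0.
have p00 : pos q0 0 = 1 by rewrite pos_pos_unit.
have p01 : pos q0 1 = 0 by rewrite pos_pos_unit.
have xp j : (j <= n)%N -> pos x j = 0.
  move=> jn; have := congr1 (fun u : phase => mom u (swap01 j)) (xc q0).
  rewrite (mom_tslie_ker q0 sx (swap01_lt jn)) p01 p00 tscP_q0 sig1 mul1r mom0.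
  rewrite mulr0 mul0r subrr mulr0 sub0r => /eqP; rewrite oppr_eq0 => /eqP.
  by case: j {jn} => [|[|j]].
pose a : C := (Im (mom x 1) / (1 - eps))%:C * 'i%C.
pose b : C := (- Re (mom x 1) / 2)%:C * 'i%C.
pose w : phase :=
  of_coords n (fun j => if j == 0%N then 0 else mom x (swap01 j)) (fun=> 0).
have w0 : pos w 0 = 0 by rewrite pos_of.
have d0 : 1 - eps != 0 by rewrite subr_eq0 eq_sym.
have aE : a - s a = 0 +i* Im (mom x 1).
  by apply/eqP; rewrite eq_complex /=; apply/andP; split; apply/eqP; field.
have bE : 'i%C * (b - conj b) = (Re (mom x 1))%:C.
  by apply/eqP; rewrite eq_complex /=; apply/andP; split; apply/eqP; field.
have inD (y z : g) f : (forall j, (j <= n)%N -> mom [lie y, z] j = f j) ->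
    exists2 u : phase, (u : g) \in lcs g 1 &
      forall j, (j <= n)%N -> pos u j = 0 /\ mom u j = f j.
  move=> yzE; exists [lie y, z]; first by rewrite memv_lie ?memvf.
  by move=> j jn; split; [exact: pos_tslie | exact: yzE].
have [u uD uE] := inD q0 w _ (fun j => mom_lie_q0_ts w0).
have [v vD vE] := inD q0 (a *: q0 : phase) _ (mom_lie_scale_q0 a).
have [t tD tE] := inD q1 (b *: q1 : phase) _ (mom_lie_scale_q1 b).
have xE : (x : phase) = u + v + t.
  apply: phaseP => j jn; rewrite (posD (u + v)) (posD u) (momD (u + v)) (momD u).
  have [-> ->] := uE j jn; have [-> ->] := vE j jn; have [-> ->] := tE j jn.
  rewrite xp // !addr0 aE bE; split=> //.
  case: (eqVneq j 1%N) => [->|j1] /=.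
    rewrite w0 !mulr1 add0r; case: (mom x 1) => r i.
    by apply/eqP; rewrite eq_complex /= add0r addr0 !eqxx.
  rewrite !mulr0 !addr0 pos_of ?swap01_lt //.
  by case: j jn j1 => [|[|j]].
have -> : x = (u + v + t : g) := xE.
by rewrite !memvD.
Qed.

Lemma two_step_indecomposable : eps != 1 -> indecomposable g.
Proof.
move=> eps1.
apply: (@indecomposableI _ g q1 (@re_pos0 R n : {scalar g}) q0).
- move=> x y /centralizer_q1_ts [sx ix] /centralizer_q1_ts [sy iy].
  apply: phaseP => j jn; rewrite pos_tslie mom_tslie_ker // sy mul0r subr0 pos0 mom0.
  split=> //; rewrite /tscP (_ : _ - _ = 0) ?mulr0 //.
  case: (pos x 1) (pos y 1) ix iy => [u v] [u' v'] /= -> ->.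
  by apply/eqP; rewrite eq_complex /=; apply/andP; split; apply/eqP; ring.
- by move=> a /centralizer_q1_ts[sa _]; exact: two_step_centralizer.
- rewrite /= /re_pos0 pos_pos_unit //=; apply/eqP; exact: oner_neq0.
- by move=> x; exact: two_step_center.
Qed.

End TwoStep.

(** * Existence in each dimension and step *)

Section Flat.
Variables (R : rcfType) (n : nat).
Local Notation C := R[i].
Local Notation phase := (phase R n.+1).

Fact flat_lin : real_linear (fun _ : phase => 0 : C).
Proof. by move=> a x y; rewrite mulr0 addr0. Qed.
Fact flatPN (u : phase) : spP ord0 (spN 0 0 u) = 0.
Proof. by rewrite spN.unlock spP.unlock /= mulmx0 mxE scale0r. Qed.
Fact flatNP (u : phase) : spN 0 0 (spP ord0 u) = 0.
Proof. by rewrite spN.unlock spP.unlock /= trmx0 !mulmx0 subrr. Qed.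

Fact flatP_N (x y z : phase) : (0 : C) *: spP ord0 z = 0 *: spP ord0 x.
Proof. by rewrite (scale0r (spP ord0 z)) (scale0r (spP ord0 x)). Qed.

(** The Abelian Lie algebra, for step 1. *)
Definition flat : shear R n.+1 :=
  Shear (trmx0 _ _ _) flat_lin flat_lin flatPN flatNP (fun=> erefl) (fun=> erefl)
    (fun=> erefl) flatP_N.

Notation g := (shear_algebra flat).

Lemma lie_flat (x y : g) : [lie x, y] = 0.
Proof.
apply: phaseP => j jn; rewrite [pos _ j]pos_lie [mom _ j]mom_lie /=.
by rewrite !mul0r addr0 subrr pos0 mom0.
Qed.

Lemma flat_step : nilpotent_of_step g 1.
Proof.
pose P l (x : g) := if l is 0 then True else x = 0.
have fP : lie_filtration P.
  split=> //; first by case.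
    by case=> [|l] a x y //= -> ->; rewrite scaler0 addr0.
  by case=> [|l] x y _; rewrite /P lie_flat.
apply: (filtration_step fP (x := pos_unit R n 0) (y := 0)) => //= e.
have := congr1 (fun u : phase => pos u 0) e.
by rewrite pos_pos_unit // pos0 => /eqP; rewrite oner_eq0.
Qed.
End Flat.

Section Existence.
Variables (R : realType) (n : nat).

Let nN1 : (-1 : R) != 1.
Proof. by apply/eqP; lra. Qed.
Let n0N1 : (0 : R) != -1.
Proof. by apply/eqP; lra. Qed.
Let n1N1 : (1 : R) != -1.
Proof. by apply/eqP; lra. Qed.
Let n01 : (0 : R) != 1.
Proof. by apply/eqP; lra. Qed.

Lemma exists_nonabelian m : (2 <= m <= 2 * n.+1)%N -> (n.+1, m) <> (1%N, 2%N) ->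
  exists (g : lieAlgType R) (J : 'End(g)) (omega : {skew_symmetric g}),
      [/\ \dim {:g} = (4 * n.+1)%N,
          nilpotent_of_step g m,
          complex_symplectic J omega,
          indecomposable g
        & ~ abelian_cs J /\ nilpotent_cs J].
Proof.
case/andP=> m2 mn nm; case: (eqVneq m 2%N) => [e|m3].
  have n0 : (0 < n)%N by case: (n) nm => //; rewrite e.
  exists (shear_algebra (two_step (0 : R) n0)), (shear_J _), (phase_omega R n.+1).
  split; first exact: dim_shear_algebra.
  - by rewrite e; exact: two_step_step n01.
  - exact: shear_complex_symplectic.
  - exact: two_step_indecomposable n01.
  split; [exact: two_step_not_abelian n0N1 | exact: two_step_nilpotent_cs].
pose k := (m.-1)./2; pose ev := ~~ odd m.
have kn : (k <= n)%N by rewrite /k; lia.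
have k0 : (0 < k)%N by rewrite /k; lia.
have k_gt0 : ~~ ev -> (0 < k)%N by [].
have ms : m = chain_length k ev by rewrite /chain_length /k /ev; lia.
(* eps = 1 would kill [q_0, i q_0] in the even case, and eps = 0 is not an
   involution as the odd case requires *)
pose eps : R := if ev then 0 else 1.
have eps2 : ~~ ev -> eps * eps = 1 by rewrite /eps => /negPf->; rewrite mulr1.
exists (shear_algebra (chain kn k_gt0 eps2)), (shear_J _), (phase_omega R n.+1).
split; first exact: dim_shear_algebra.
- by rewrite ms; apply: chain_step; rewrite /eps => ->.
- exact: shear_complex_symplectic.
- exact: chain_indecomposable.
split; last exact: chain_nilpotent_cs.
by apply: chain_not_abelian => //; rewrite /eps; case: (ev).
Qed.

Lemma exists_abelian m : (2 <= m <= 2 * n.+1)%N -> (n.+1, m) <> (1%N, 2%N) ->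
  exists (g : lieAlgType R) (J : 'End(g)) (omega : {skew_symmetric g}),
      [/\ \dim {:g} = (4 * n.+1)%N,
          nilpotent_of_step g m,
          complex_symplectic J omega,
          indecomposable g
        & abelian_cs J].
Proof.
case/andP=> m2 mn nm; case: (eqVneq m 2%N) => [e|m3].
  have n0 : (0 < n)%N by case: (n) nm => //; rewrite e.
  exists (shear_algebra (two_step (-1 : R) n0)), (shear_J _), (phase_omega R n.+1).
  split; first exact: dim_shear_algebra.
  - by rewrite e; exact: two_step_step nN1.
  - exact: shear_complex_symplectic.
  - exact: two_step_indecomposable nN1.
  exact: two_step_abelian.
pose k := (m.-1)./2; pose ev := ~~ odd m.
have kn : (k <= n)%N by rewrite /k; lia.
have k0 : (0 < k)%N by rewrite /k; lia.
have k_gt0 : ~~ ev -> (0 < k)%N by [].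
have ms : m = chain_length k ev by rewrite /chain_length /k /ev; lia.
have eps2 : ~~ ev -> -1 * -1 = 1 :> R by rewrite mulrNN mulr1.
exists (shear_algebra (chain kn k_gt0 eps2)), (shear_J _), (phase_omega R n.+1).
split; first exact: dim_shear_algebra.
- by rewrite ms; apply: chain_step.
- exact: shear_complex_symplectic.
- exact: chain_indecomposable.
exact: chain_abelian.
Qed.

(** Beyond step 1, the only case left by indecomposable algebras is n = 1, m = 2:
    there the even chain with k = 0, of basis q_0, i q_0, p_0, i p_0. *)
Lemma exists_any m : (1 <= m <= 2 * n.+1)%N ->
  exists (g : lieAlgType R) (J : 'End(g)) (omega : {skew_symmetric g}),
     [/\ \dim {:g} = (4 * n.+1)%N,
         nilpotent_of_step g m
       & complex_symplectic J omega].
Proof.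
case/andP=> m1 mn; case: (eqVneq m 1%N) => [e|m2].
  exists (shear_algebra (flat R n)), (shear_J _), (phase_omega R n.+1).
  split; first exact: dim_shear_algebra.
    by rewrite e; exact: flat_step.
  exact: shear_complex_symplectic.
case: (eqVneq (n.+1, m) (1%N, 2%N)) => [[n0 e]|/eqP nm]; last first.
  have [|g [J [w [dimg stepg Jw _ _]]]] := exists_abelian (m := m) _ nm; first by lia.
  by exists g, J, w.
have eps2 : ~~ true -> -1 * -1 = 1 :> R by [].
have k_gt0 : ~~ true -> (0 < 0)%N by [].
exists (shear_algebra (chain (leq0n n) k_gt0 eps2)), (shear_J _), (phase_omega R n.+1).
split; first exact: dim_shear_algebra.
  by rewrite e; apply: chain_step.
exact: shear_complex_symplectic.
Qed.
End Existence.

Theorem proposition6p5 (R : realType) (n m : nat) (hm : (1 <= m <= 2 * n)%N) :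
  (exists (g : lieAlgType R) (J : 'End(g)) (omega : {skew_symmetric g}),
     [/\ \dim {:g} = (4 * n)%N,
         nilpotent_of_step g m
       & complex_symplectic J omega]) /\
  ((2 <= m)%N -> (n, m) <> (1%N, 2%N) ->
   (exists (g : lieAlgType R) (J : 'End(g)) (omega : {skew_symmetric g}),
      [/\ \dim {:g} = (4 * n)%N,
          nilpotent_of_step g m,
          complex_symplectic J omega,
          indecomposable g
        & ~ abelian_cs J /\ nilpotent_cs J]) /\
   (exists (g : lieAlgType R) (J : 'End(g)) (omega : {skew_symmetric g}),
      [/\ \dim {:g} = (4 * n)%N,
          nilpotent_of_step g m,
          complex_symplectic J omega,
          indecomposable g
        & abelian_cs J])).
Proof.
case: n hm => [|n] hm; first by lia.
split; first exact: exists_any.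
move=> m2 nm; have m2n : (2 <= m <= 2 * n.+1)%N by lia.
by split; [exact: exists_nonabelian | exact: exists_abelian].
Qed.
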